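(* Let $A[1..n]$ be an array of $n$ numbers. In the word-RAM model with word size $\Theta(\lg n)$ bits, there is a data structure built from $A$ that occupies $3n + o(n)$ bits of space (and does not need access to $A$ afterwards) such that any query $\textsc{RMinMax}(A[i..j])$, for $1 \le i \le j \le n$, can be answered in $\mathcal{O}(1)$ time.
   Context: A range min-max query $\textsc{RMinMax}(A[i..j])$ on a subarray $A[i..j]$ asks for the ordered pair of indices $\{\ell_1,\ell_2\}$ where $\ell_1 = \arg\max_{\ell\in[i,j]} A[\ell]$ and $\ell_2 = \arg\min_{\ell\in[i,j]}A[\ell]$; ties among equal values are broken in favour of the leftmost element (equivalently, the values are treated as a permutation with ties broken leftmost-first). $\lg$ denotes $\log_2$.
   Formalization: Equal values are ordered by position in one total order (either direction), so on ties only one of maximum and minimum is leftmost, the other rightmost; leftmost for both is impossible in 3n+o(n) bits (about 9^n distinguishable arrays). Words are assumed to hold every index up to n. *)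

(* Defs.v *)
(* MathComp / MathComp-Analysis *)
From Stdlib Require PeanoNat.
From mathcomp Require Import all_boot all_order all_algebra.
From mathcomp Require Import all_classical reals topology normedtype landau exp.

Set Implicit Arguments.
Unset Strict Implicit.
Unset Printing Implicit Defensive.

Import Order.TTheory GRing.Theory Num.Theory.
Import numFieldNormedType.Exports.

Local Open Scope nat_scope.

(* Word RAM with word size w.  A word is a natural number below 2 ^ w.  A      *)
(* program is a finite list of instructions over word registers and a random  *)
(* access memory of words; it does not depend on the input size, and each     *)
(* instruction takes one unit of time.                                        *)

Definition reg := nat.

Variant binop :=
  | OpAdd | OpSub | OpMul | OpDiv | OpMod | OpAnd | OpOr | OpXor | OpShl | OpShr
  | OpLt | OpEq.

Variant instr :=
  | Const of reg & nat
  | Move of reg & reg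
  | Binop of binop & reg & reg & reg
  | Read of reg & reg             (* Read d a : d := memory[a] *)
  | Write of reg & reg            (* Write a s : memory[a] := s *)
  | JumpIfZero of reg & nat.      (* JumpIfZero s l : goto l if s = 0 *)

Definition program := seq instr.

(* OpSub wraps around modulo 2 ^ w (for operands below 2 ^ w), and x / 0 = 0, *)
(* x mod 0 = x.                                                               *)
Definition eval_binop (w : nat) (o : binop) (x y : nat) : nat :=
  (match o with
   | OpAdd => x + y
   | OpSub => x + 2 ^ w - y
   | OpMul => x * y
   | OpDiv => x %/ y
   | OpMod => x %% y
   | OpAnd => PeanoNat.Nat.land x y
   | OpOr => PeanoNat.Nat.lor x y
   | OpXor => PeanoNat.Nat.lxor x y
   | OpShl => x * 2 ^ y
   | OpShr => x %/ 2 ^ y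
   | OpLt => x < y
   | OpEq => x == y
   end) %% 2 ^ w.

Record state := State {
  pc : nat;
  regs : reg -> nat;
  mem : nat -> nat
}.

Definition exec (w : nat) (c : instr) (s : state) : state :=
  let: State p r m := s in
  match c with
  | Const d k => State p.+1 [eta r with d |-> k %% 2 ^ w] m
  | Move d a => State p.+1 [eta r with d |-> r a] m
  | Binop o d a b => State p.+1 [eta r with d |-> eval_binop w o (r a) (r b)] m
  | Read d a => State p.+1 [eta r with d |-> m (r a)] m
  | Write a b => State p.+1 r [eta m with r a |-> r b]
  | JumpIfZero a l => State (if r a == 0 then l else p.+1) r m
  end.

(* The machine halts when the program counter leaves the program; halted      *)
(* states are fixed by step, so iter t (step w P) runs P for at most t steps. *)
Definition halted (P : program) (s : state) : bool := size P <= pc s.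

Definition step (w : nat) (P : program) (s : state) : state :=
  if onth P (pc s) is Some c then exec w c s else s.

(* A bit string packed into words, least significant bit first, followed by   *)
(* zeros.                                                                     *)
Definition memory_of_bits (w : nat) (D : seq bool) (a : nat) : nat :=
  \sum_(b < w) nth false D (a * w + b) * 2 ^ b.

Definition query_start (w : nat) (D : seq bool) (i j : nat) : state :=
  State 0 (nth 0 [:: i; j]) (memory_of_bits w D).

(* Requiring the memory to be restored makes D usable for further queries.    *)
Definition answers_query (w : nat) (P : program) (t : nat) (D : seq bool)
    (i j l1 l2 : nat) : Prop :=
  let s := iter t (step w P) (query_start w D i j) in
  [/\ halted P s, mem s =1 memory_of_bits w D, regs s 0 = l1 & regs s 1 = l2].

(* Equal values are told apart by their position, which turns the array into  *)
(* a permutation.  Either the earlier of two equal values is the smaller one  *)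
(* (so the minimum is the leftmost one), or it is the larger one (so the      *)
(* maximum is the leftmost one).  Taking the leftmost maximum and the         *)
(* leftmost minimum at the same time is not induced by any permutation: on    *)
(* two equal values both indices would coincide.  At least 9 ^ n / poly(n)    *)
(* arrays would then have to be distinguished (insert copies of their         *)
(* predecessors into the about 8 ^ m permutations of size m = n - k that are  *)
(* pairwise distinguishable), which 3 n + o(n) bits cannot do.                *)
Variant tie_rule := EarlierIsSmaller | EarlierIsLarger.

Section RangeMinMax.
Variables (R : realType) (T : tie_rule) (n : nat) (A : n.-tuple R).

Definition entry (k : nat) : R := nth 0%R A k.-1.  (* A[k], 1 <= k <= n *)

Definition precedes (k l : nat) : bool :=
  (entry k < entry l)%R ||
  ((entry k == entry l) &&
   match T with EarlierIsSmaller => k < l | EarlierIsLarger => l < k end).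

Definition is_argmax (i j l : nat) : Prop :=
  i <= l <= j /\ forall k, i <= k <= j -> k != l -> precedes k l.

Definition is_argmin (i j l : nat) : Prop :=
  i <= l <= j /\ forall k, i <= k <= j -> k != l -> precedes l k.

Definition is_RMinMax (i j l1 l2 : nat) : Prop :=
  is_argmax i j l1 /\ is_argmin i j l2.

End RangeMinMax.

Definition lg (R : realType) (x : R) : R := (ln x / ln 2)%R.

Section Asymptotics.
Variable R : realType.
Local Open Scope ring_scope.
Local Open Scope classical_set_scope.

(* A word can hold every index of the array, and w(n) = Theta(lg n).          *)
Definition word_size (w : nat -> nat) : Prop :=
  (forall n, n < 2 ^ w n)%N /\
  ((fun n => (w n)%:R : R^o) =Theta_\oo (fun n => lg (n%:R : R) : R^o)).

Definition sublinear (r : nat -> nat) : Prop :=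
  (fun n => (r n)%:R : R^o) =o_\oo (fun n => n%:R : R^o).

End Asymptotics.

Lemma argmax_leftmost (R : realType) n (A : n.-tuple R) i j l :
  is_argmax EarlierIsLarger A i j l <->
  [/\ i <= l <= j, forall k, i <= k <= j -> (entry A k <= entry A l)%R
    & forall k, i <= k < l -> (entry A k < entry A l)%R].
Proof.
split=> [[lij lmax]|[lij lmax lfst]].
- split=> // k.
    have [-> //|kl] := eqVneq k l.
    by move=> /lmax /(_ kl) /orP[/ltW //|/andP[/eqP -> _]].
  move=> /andP[ik kl]; have kj : i <= k <= j.
    by rewrite ik (leq_trans (ltnW kl)) //; case/andP: lij.
  have /orP[//|/andP[_ /=]] := lmax k kj (negbT (ltn_eqF kl)).
  by rewrite ltnNge (ltnW kl).
- split=> // k kij; rewrite neq_ltn => /orP[kl|lk].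
    by rewrite /precedes lfst //; case/andP: kij => ->.
  by rewrite /precedes /= lk andbT orbC -le_eqVlt lmax.
Qed.

Lemma argmin_leftmost (R : realType) n (A : n.-tuple R) i j l :
  is_argmin EarlierIsSmaller A i j l <->
  [/\ i <= l <= j, forall k, i <= k <= j -> (entry A l <= entry A k)%R
    & forall k, i <= k < l -> (entry A l < entry A k)%R].
Proof.
split=> [[lij lmin]|[lij lmin lfst]].
- split=> // k.
    have [-> //|kl] := eqVneq k l.
    by move=> /lmin /(_ kl) /orP[/ltW //|/andP[/eqP -> _]].
  move=> /andP[ik kl]; have kj : i <= k <= j.
    by rewrite ik (leq_trans (ltnW kl)) //; case/andP: lij.
  have /orP[//|/andP[_ /=]] := lmin k kj (negbT (ltn_eqF kl)).
  by rewrite ltnNge (ltnW kl).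
- split=> // k kij; rewrite neq_ltn => /orP[kl|lk].
    by rewrite /precedes lfst //; case/andP: kij => ->.
  by rewrite /precedes /= lk andbT orbC -le_eqVlt lmin.
Qed.

(* Main.v *)
(* Process the array from left to right, keeping the stack of suffix maxima and *)
(* the stack of suffix minima.  The maximum of A[i..j] is the rightmost place   *)
(* in [i, j] where the stack of suffix maxima is lowest just after that entry   *)
(* was pushed, and likewise for the minimum.  Appending an entry pops from      *)
(* exactly one of the two stacks, and from that one at least one element; so a  *)
(* step is described by one bit (which stack) and, in unary, the number of pops *)
(* less one.  As at most n elements are ever popped from each stack, this takes *)
(* 3 n bits.                                                                    *)
(*                                                                              *)
(* For queries the steps are cut into blocks of s = Theta(w / lg w) steps, and  *)
(* G = w^O(1) blocks form a superblock.  A block is coded in unary, or with     *)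
(* O(lg w) bits per step if that is shorter; either way its code has at most    *)
(* w / K bits, and tables indexed by codes answer all questions inside a block. *)
(* In these tables a step pops at most C elements: this does not change the     *)
(* order of depths inside a block, and the at most n / C clipped steps are      *)
(* listed apart.  Positions of codes and pop counts are stored absolutely per   *)
(* superblock and with O(lg w) bits per block; sparse tables find the minimum   *)
(* over 2^l blocks (l <= lg G) or over 2^l superblocks.                         *)
(*                                                                              *)
(* All programs are straight-line code compiled from expression trees, with     *)
(* case distinctions done arithmetically.  The finitely many n with small w are *)
(* treated by storing the ranks of all entries and scanning.                    *)

Require Import Defs.
From mathcomp Require Import all_boot all_order all_algebra.
From mathcomp Require Import all_classical reals topology normedtype landau exp.
From mathcomp Require Import zify.

Set Implicit Arguments.
Unset Strict Implicit.
Unset Printing Implicit Defensive.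

Import Order.TTheory GRing.Theory Num.Theory.
Import numFieldNormedType.Exports.

Local Open Scope classical_set_scope.
Local Open Scope nat_scope.

(** * Straight-line programs *)

(** Why depths suffice: let [l] be the maximum of a range. An earlier position of the range has at
    least the depth of [l] ([depth_ge]), because pushing [l] pops it and all that lies above it; a
    later one is strictly deeper ([depth_gt]), because [l] is still below it on the stack. So the
    rightmost position of least depth is the maximum ([max_is_best], [best_is_max]), and queries
    need only the pop counts of the two stacks. There are at most [2 n] pops in all and every step
    makes at least one, so the numbers [y] of pops less one add up to at most [n] ([pops_encoding]);
    a step costs [y + 2] bits, hence [3 n] in total.

    Why constant time: comparisons inside a block survive clipping ([wins_clip]) and global counts
    are recovered from clipped ones ([pops_excess]). A clipped block has a short code that
    determines it ([decodeK]), so tables indexed by codes ([ev_key]) yield the pop count at any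
    position ([ev_pops]) and the best position inside a block ([finds_block]). The best of a union
    is the better of two bests ([is_best_merge]), so [finds_query] needs boundedly many lookups.

    Why [o(n)] extra bits: a block holds about [w / lg w] steps and carries [O(lg^2 w)] bits of
    directory, and the tables take [2 ^ b * w^O(1)] bits for code length [b]. As [w = O(lg n)], a
    constant [K] with [4 ^ (w %/ K) <= n] exists for large [n] ([word_size_exp], [code_len_exp]), so
    the tables are negligible ([encoding_words], [redundancy_le]). For the remaining [n] a scan over
    stored ranks works ([ev_scan]). *)

Inductive expr :=
  | Arg of bool
  | Lit of nat
  | Op of binop & expr & expr
  | Fetch of expr.

Fixpoint eval_expr (w : nat) (m : nat -> nat) (i j : nat) (e : expr) : nat :=
  match e with
  | Arg b => if b then j else i
  | Lit k => k %% 2 ^ w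
  | Op o a b => eval_binop w o (eval_expr w m i j a) (eval_expr w m i j b)
  | Fetch a => m (eval_expr w m i j a)
  end.

(** Registers 0 and 1 keep the query arguments, the boolean of [Arg] being read as a register
    number. Only registers from [d] on are written, so a left operand in [d] survives the evaluation
    of the right one in [d.+1]. *)
Fixpoint compile (d : reg) (e : expr) : program :=
  match e with
  | Arg b => [:: Move d b]
  | Lit k => [:: Const d k]
  | Op o a b => compile d a ++ compile d.+1 b ++ [:: Binop o d d d.+1]
  | Fetch a => compile d a ++ [:: Read d d]
  end.

Definition straight (c : instr) : bool :=
  match c with Write _ _ | JumpIfZero _ _ => false | _ => true end.

Definition run (w : nat) (m : nat -> nat) (P : program) (r : reg -> nat) :
    reg -> nat :=
  foldl (fun r c => regs (exec w c (State 0 r m))) r P.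

Lemma run_cat w m P1 P2 r : run w m (P1 ++ P2) r = run w m P2 (run w m P1 r).
Proof. by rewrite /run foldl_cat. Qed.

(** The prefix [P0] serves the induction, which moves executed instructions into it. With neither
    writes nor jumps the memory never changes, so it needs no restoring. *)
Lemma iter_straight w m P0 P r : all straight P ->
  iter (size P) (step w (P0 ++ P)) (State (size P0) r m) =
  State (size (P0 ++ P)) (run w m P r) m.
Proof.
elim: P P0 r => [|c P IH] P0 r /=; first by rewrite cats0.
move=> /andP[sc sP]; rewrite -iterS iterSr -cat_rcons.
have -> : step w (rcons P0 c ++ P) (State (size P0) r m) =
    State (size (rcons P0 c)) (regs (exec w c (State 0 r m))) m.
  rewrite /step /= onthE map_cat nth_cat size_map size_rcons ltnS leqnn.
  rewrite map_rcons nth_rcons size_map ltnn eqxx.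
  by case: c sc.
by rewrite IH.
Qed.

Lemma compile_straight d e : all straight (compile d e).
Proof.
by elim: e d => //= [bo a IHa b IHb|a IHa] d; rewrite !all_cat IHa ?IHb.
Qed.

Lemma run_compile w m i j d e r : 1 < d -> r 0 = i -> r 1 = j ->
  run w m (compile d e) r d = eval_expr w m i j e /\
  forall k, k < d -> run w m (compile d e) r k = r k.
Proof.
elim: e d r => [b|c|bo a IHa b IHb|a IHa] d r d1 r0 r1 /=.
- rewrite /run /= eqxx; split; first by case: b.
  by move=> k kd; rewrite ltn_eqF.
- by rewrite /run /= eqxx; split=> // k kd; rewrite ltn_eqF.
- have [ea ka] := IHa d r d1 r0 r1.
  have [| | | eb kb] := IHb d.+1 (run w m (compile d a) r).
  + exact: ltnW.
  + by rewrite ka // ltnW.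
  + by rewrite ka.
  rewrite !run_cat {1 3}/run /= eqxx eb kb // ea; split=> // k kd.
  by rewrite ltn_eqF // kb ?ka // ltnW.
- have [ea ka] := IHa d r d1 r0 r1.
  rewrite run_cat {1 3}/run /= eqxx ea; split=> // k kd.
  by rewrite ltn_eqF // ka.
Qed.

(** The results wait in registers 2 and 3, since registers 0 and 1 hold the arguments until both
    expressions are evaluated. *)
Definition program_of (e1 e2 : expr) : program :=
  compile 2 e1 ++ compile 3 e2 ++ [:: Move 0 2; Move 1 3].

Lemma program_ofP w D i j e1 e2 :
  answers_query w (program_of e1 e2) (size (program_of e1 e2)) D i j
    (eval_expr w (memory_of_bits w D) i j e1) (eval_expr w (memory_of_bits w D)
      i j e2).
Proof.
set P := program_of e1 e2; set m := memory_of_bits w D.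
have sP : all straight P.
  by rewrite /P /program_of !all_cat !compile_straight.
have := iter_straight w m [::] (nth 0 [:: i; j]) sP; rewrite cat0s => H.
rewrite /answers_query /query_start H /halted /=.
set r := nth 0 [:: i; j].
have [v1 k1] := @run_compile w m i j 2 e1 r isT erefl erefl.
have [|| v2 k2] := @run_compile w m i j 3 e2 (run w m (compile 2 e1) r) isT.
- by rewrite k1.
- by rewrite k1.
split=> //.
- by rewrite /P /program_of !run_cat {1}/run /= k2 // v1.
- by rewrite /P /program_of !run_cat {1}/run /= v2.
Qed.

(** * Words and bits *)

Definition digits (B : nat) (a : nat -> nat) (len : nat) : nat :=
  \sum_(t < len) a t * B ^ t.

Lemma eq_digits B a a' len :
  (forall t, t < len -> a t = a' t) -> digits B a len = digits B a' len.
Proof. by move=> eqa; apply: eq_bigr => t _; rewrite eqa. Qed.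

Lemma digits_lt B a len :
  (forall t, t < len -> a t < B) -> digits B a len < B ^ len.
Proof.
elim: len => [|len IH] aB; first by rewrite /digits big_ord0.
rewrite /digits big_ord_recr /=.
have := IH (fun t tl => aB t (ltnW tl)); rewrite /digits.
have := aB len (ltnSn len); rewrite expnS.
set S := \sum_(_ < _) _; set p := B ^ len => ha hS.
have := leq_mul ha (leqnn p); lia.
Qed.

Lemma digits_cat B a len1 len2 :
  digits B a (len1 + len2) =
  digits B a len1 + digits B (fun t => a (len1 + t)) len2 * B ^ len1.
Proof.
rewrite /digits big_split_ord /= big_distrl /=; congr addn.
by apply: eq_bigr => t _; rewrite expnD -mulnA [B ^ t * _]mulnC.
Qed.

Lemma digits_modn B a u len : (forall t, t < len -> a t < B) -> u <= len ->
  digits B a len %% B ^ u = digits B a u.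
Proof.
move=> aB ul; rewrite -(subnKC ul) digits_cat addnC modnMDl modn_small //.
by apply: digits_lt => t tu; apply: aB; apply: leq_trans ul.
Qed.

Lemma digits_divn B a u len : (forall t, t < len -> a t < B) -> u <= len ->
  digits B a len %/ B ^ u = digits B (fun t => a (u + t)) (len - u).
Proof.
move=> aB ul; rewrite -{1}(subnKC ul) digits_cat addnC.
have lt : digits B a u < B ^ u.
  by apply: digits_lt => t tu; apply: aB; apply: leq_trans ul.
by rewrite divnMDl ?(leq_ltn_trans _ lt) // divn_small ?addn0.
Qed.

Lemma digit_get B a u len : (forall t, t < len -> a t < B) -> u < len ->
  digits B a len %/ B ^ u %% B = a u.
Proof.
move=> aB ul; rewrite digits_divn ?(ltnW ul) // -{2}[B]expn1 digits_modn.
- by rewrite /digits big_ord1 addn0 muln1.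
- by move=> t tl; apply: aB; lia.
- by lia.
Qed.

Lemma bits_lt (z : nat -> bool) len t : t < len -> nat_of_bool (z t) < 2.
Proof. by case: (z t). Qed.

Lemma bits_digits_lt (z : nat -> bool) len : digits 2 z len < 2 ^ len.
Proof. by apply: digits_lt => t; apply: bits_lt. Qed.

Definition bit (x t : nat) : bool := odd (x %/ 2 ^ t).

Lemma digits_bits x len : digits 2 (bit x) len = x %% 2 ^ len.
Proof.
elim: len => [|len IH]; first by rewrite /digits big_ord0 expn0 modn1.
rewrite -[len.+1]addn1 digits_cat IH {1}/digits big_ord1 expn0 muln1 addn0 /bit.
rewrite -modn2 addn1 expnS; set p := 2 ^ len.
have p0 : 0 < p by rewrite /p expn_gt0.
have xq := divn_eq x p; have := ltn_pmod x p0.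
set q := x %/ p in xq *; set r := x %% p in xq * => rp.
have qq := divn_eq q 2; have := ltn_pmod q (isT : 0 < 2).
set q2 := q %/ 2 in qq *; set r2 := q %% 2 in qq * => r2lt.
have -> : x = q2 * (2 * p) + (r2 * p + r) by nia.
rewrite modnMDl modn_small; nia.
Qed.

Lemma nth_flatten_shape (T : Type) (x : T) (ss : seq (seq T)) k t :
  t < size (nth [::] ss k) ->
  nth x (flatten ss) (sumn (take k (shape ss)) + t) = nth x (nth [::] ss k) t.
Proof.
elim: ss k => [|s ss IH] [|k] //= ts.
  by rewrite nth_cat ts.
by rewrite -addnA nth_cat ltnNge leq_addr /= addKn IH.
Qed.

Lemma flatten_shape_lt (T : Type) (ss : seq (seq T)) k t :
  t < size (nth [::] ss k) ->
  sumn (take k (shape ss)) + t < size (flatten ss).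
Proof.
elim: ss k => [|s ss IH] [|k] //= ts; rewrite size_cat.
  by rewrite ltn_addr.
by rewrite -addnA ltn_add2l IH.
Qed.

Definition bits_of_words (w : nat) (W : seq nat) : seq bool :=
  flatten [seq mkseq (bit x) w | x <- W].

Lemma size_bits_of_words w W : size (bits_of_words w W) = size W * w.
Proof.
elim: W => //= x W IH; rewrite /bits_of_words /= size_cat size_mkseq.
by rewrite -/(bits_of_words w W) IH.
Qed.

Lemma nth_bits_of_words w W a t : a < size W -> t < w ->
  nth false (bits_of_words w W) (a * w + t) = bit (nth 0 W a) t.
Proof.
move=> aW tw.
have e : nth [::] [seq mkseq (bit x) w | x <- W] a = mkseq (bit (nth 0 W a)) w.
  by rewrite (nth_map 0).
have -> : a * w = sumn (take a (shape [seq mkseq (bit x) w | x <- W])).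
  have -> : shape [seq mkseq (bit x) w | x <- W] = nseq (size W) w.
    by elim: W {aW e} => //= x W ->; rewrite size_mkseq.
  by rewrite take_nseq ?(ltnW aW) // sumn_nseq mulnC.
by rewrite /bits_of_words nth_flatten_shape e ?size_mkseq // nth_mkseq.
Qed.

Lemma memory_of_words w W st a : a < size W ->
  memory_of_bits w (bits_of_words w W ++ st) a = nth 0 W a %% 2 ^ w.
Proof.
move=> aW; rewrite -digits_bits; apply: eq_bigr => t _.
rewrite nth_cat size_bits_of_words nth_bits_of_words //.
by rewrite ifT //; have := ltn_ord t; nia.
Qed.

Lemma memory_of_stream w W st a :
  memory_of_bits w (bits_of_words w W ++ st) (size W + a) =
  memory_of_bits w st a.
Proof.
apply: eq_bigr => t _.
rewrite mulnDl -addnA nth_cat size_bits_of_words ltnNge leq_addr /=.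
by rewrite addKn.
Qed.

Lemma memory_of_bits_lt w D a : memory_of_bits w D a < 2 ^ w.
Proof.
have -> : memory_of_bits w D a = digits 2 (fun t => nth false D (a * w + t)) w.
  by [].
by apply: digits_lt => t _; case: (nth _ _ _).
Qed.

(* The two words overlap in no bit, and the bits of the second word that do    *)
(* not fit are lost in the shift.                                              *)
Lemma unaligned_word w D a u : u < w ->
  (memory_of_bits w D a %/ 2 ^ u +
   memory_of_bits w D a.+1 * 2 ^ (w - u) %% 2 ^ w) =
  digits 2 (fun t => nth false D (a * w + u + t)) w.
Proof.
move=> uw; pose be t : nat := nth false D (a * w + t).
have beb f len : forall t, t < len -> nat_of_bool (f t) < 2.
  by move=> t _; case: (f t).
have -> : memory_of_bits w D a = digits 2 be w by [].
have -> : memory_of_bits w D a.+1 = digits 2 (fun t => be (w + t)) w.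
  by apply: eq_bigr => t _; rewrite /be mulSn addnCA addnA.
rewrite digits_divn ?(ltnW uw) //; last exact: beb.
have -> : digits 2 (fun t => nth false D (a * w + u + t)) w =
    digits 2 (fun t => be (u + t)) ((w - u) + u).
  by rewrite subnK ?(ltnW uw) //; apply: eq_digits => t _; rewrite /be addnA.
have -> : 2 ^ w = 2 ^ u * 2 ^ (w - u) by rewrite -expnD subnKC // ltnW.
rewrite digits_cat -muln_modl digits_modn ?(ltnW uw) //; last exact: beb.
congr (_ + _ * _); apply: eq_digits => t _.
by congr be; lia.
Qed.

(** * Evaluation of expressions without overflow *)

Section Evaluation.
Variables (w : nat) (m : nat -> nat) (i j : nat).

Definition ev (e : expr) (x : nat) : Prop := eval_expr w m i j e = x /\ x < 2 ^
  w.

Lemma pow_gt0 : 0 < 2 ^ w. Proof. by rewrite expn_gt0. Qed.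

Lemma ev_lit k : k < 2 ^ w -> ev (Lit k) k.
Proof. by move=> kw; split; rewrite //= modn_small. Qed.

Lemma ev_add e1 e2 x y : ev e1 x -> ev e2 y -> x + y < 2 ^ w ->
  ev (Op OpAdd e1 e2) (x + y).
Proof. by move=> [e1x _] [e2y _] xy; split;
  rewrite //= e1x e2y /eval_binop modn_small. Qed.

Lemma ev_sub e1 e2 x y : ev e1 x -> ev e2 y -> y <= x ->
  ev (Op OpSub e1 e2) (x - y).
Proof.
move=> [e1x xw] [e2y yw] xy; split; last by lia.
by rewrite /= e1x e2y /eval_binop -addnBAC // modnDr modn_small //; lia.
Qed.

Lemma ev_mul e1 e2 x y : ev e1 x -> ev e2 y -> x * y < 2 ^ w ->
  ev (Op OpMul e1 e2) (x * y).
Proof. by move=> [e1x _] [e2y _] xy; split;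
  rewrite //= e1x e2y /eval_binop modn_small. Qed.

Lemma ev_div e1 e2 x y : ev e1 x -> ev e2 y -> ev (Op OpDiv e1 e2) (x %/ y).
Proof.
move=> [e1x xw] [e2y _].
have h : x %/ y < 2 ^ w by apply: leq_ltn_trans xw; apply: leq_div.
by split; rewrite //= e1x e2y /eval_binop modn_small.
Qed.

Lemma ev_mod e1 e2 x y : ev e1 x -> ev e2 y -> ev (Op OpMod e1 e2) (x %% y).
Proof.
move=> [e1x xw] [e2y _].
have h : x %% y < 2 ^ w by apply: leq_ltn_trans xw; apply: leq_mod.
by split; rewrite //= e1x e2y /eval_binop modn_small.
Qed.

Lemma ev_shl e1 e2 x y : ev e1 x -> ev e2 y ->
  ev (Op OpShl e1 e2) (x * 2 ^ y %% 2 ^ w).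
Proof.
move=> [e1x xw] [e2y _].
by split; rewrite ?ltn_mod ?pow_gt0 //= e1x e2y.
Qed.

Lemma ev_shr e1 e2 x y : ev e1 x -> ev e2 y ->
  ev (Op OpShr e1 e2) (x %/ 2 ^ y).
Proof.
move=> [e1x xw] [e2y _].
have h : x %/ 2 ^ y < 2 ^ w by apply: leq_ltn_trans xw; apply: leq_div.
by split; rewrite //= e1x e2y /eval_binop modn_small.
Qed.

Hypotheses (w_gt0 : 0 < w) (i_lt : i < 2 ^ w) (j_lt : j < 2 ^ w)
  (m_lt : forall a, m a < 2 ^ w).

Lemma eval_lt e : eval_expr w m i j e < 2 ^ w.
Proof.
case: e => [[]|k|bo a b|a] //=; first by rewrite ltn_mod pow_gt0.
by rewrite ltn_mod pow_gt0.
Qed.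

Lemma ev_arg b : ev (Arg b) (if b then j else i).
Proof. by case: b. Qed.

Lemma ev_load e a : ev e a -> ev (Fetch e) (m a).
Proof. by move=> [ee _]; split; rewrite //= ee. Qed.

Lemma bool_lt (b : bool) : b < 2 ^ w.
Proof. by rewrite (@leq_ltn_trans 1) ?leq_b1 // -[1]/(2 ^ 0) ltn_exp2l. Qed.

Lemma ev_lt e1 e2 x y : ev e1 x -> ev e2 y -> ev (Op OpLt e1 e2) (x < y).
Proof.
move=> [e1x _] [e2y _]; split; last exact: bool_lt.
by rewrite /= e1x e2y /eval_binop modn_small // bool_lt.
Qed.

(** Both branches are always computed and the rejected one is multiplied by 0. Its value may be
    meaningless, such as a read at a wild address; it only has to be a word. *)
Definition IfE (c a b : expr) : expr :=
  Op OpAdd (Op OpMul c a) (Op OpMul (Op OpSub (Lit 1) c) b).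

Lemma ev_if (b : bool) c e1 e2 x :
  ev c b -> (b -> ev e1 x) -> (~~ b -> ev e2 x) -> ev (IfE c e1 e2) x.
Proof.
move=> cb e1x e2x.
have any e : ev e (eval_expr w m i j e) by split=> //; apply: eval_lt.
have l1 : ev (Lit 1) 1 by apply: ev_lit; apply: (bool_lt true).
rewrite /IfE; case: b cb e1x e2x => cb e1x e2x.
- have {1}-> : x = 1 * x + (1 - 1) * eval_expr w m i j e2 by lia.
  have [e1x1 xw] := e1x isT.
  apply: ev_add; last by lia.
    by apply: ev_mul; [exact: cb|exact: e1x|lia].
  by apply: ev_mul; [exact: (ev_sub l1 cb)|exact: any|rewrite subnn mul0n
    pow_gt0].
- have {1}-> : x = 0 * eval_expr w m i j e1 + (1 - 0) * x by lia.
  have [e2x1 xw] := e2x isT.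
  apply: ev_add; last by lia.
    by apply: ev_mul; [exact: cb|exact: any|rewrite mul0n pow_gt0].
  by apply: ev_mul; [exact: (ev_sub l1 cb)|exact: e2x|lia].
Qed.

End Evaluation.

(** * Stacks of suffix maxima *)

(* X k counts the pops up to position k, so k - X k is the depth of the stack  *)
(* up to a constant.  Position m wins if it is lower than k, ties going to the *)
(* right; the inequality is rearranged to avoid subtraction.                   *)
Definition wins (X : nat -> nat) (m k : nat) : bool :=
  m + X k + (m < k) <= k + X m.

Definition is_best (X : nat -> nat) (p : pred nat) (m : nat) : Prop :=
  p m /\ forall k, p k -> wins X m k.

Lemma wins_trans X m k l : wins X m k -> wins X k l -> wins X m l.
Proof. rewrite /wins; lia. Qed.

Lemma wins_total X m k : ~~ wins X m k -> wins X k m.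
Proof. rewrite /wins; lia. Qed.

Lemma is_best_uniq X p m m' : is_best X p m -> is_best X p m' -> m = m'.
Proof. by move=> [pm bm] [pm' bm']; move: (bm _ pm') (bm' _ pm); rewrite /wins;
  lia. Qed.

Lemma is_best_eq X p p' m : p =1 p' -> is_best X p m -> is_best X p' m.
Proof. by move=> e [pm bm]; split=> [|k]; rewrite -e //; apply: bm. Qed.

(** Holds because [wins X] is a total order. The two sets may overlap, which is what sparse tables
    rely on. *)
Lemma is_best_merge X p p' k l : is_best X p k -> is_best X p' l ->
  is_best X (fun t => p t || p' t) (if wins X k l then k else l).
Proof.
move=> [pk bk] [pl bl]; case: ifP => h; split; rewrite /= ?pk ?pl ?orbT //.
- move=> t /orP[/bk //|/bl]; exact: wins_trans h.
- have {}h := wins_total (negbT h).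
  move=> t /orP[/bk|/bl //]; exact: wins_trans h.
Qed.

Definition pops (U : nat -> bool) (y : nat -> nat) (s : bool) (k : nat) : nat :=
  \sum_(l < k) (if U l == s then (y l).+1 else 0).

Section Stack.
Variable lt : rel nat.
Hypotheses (lt_irr : irreflexive lt) (lt_trans : transitive lt)
  (lt_total : forall k l, k != l -> lt k l || lt l k).

Definition on_stack (k l : nat) : bool := all (lt^~ l) (iota l.+1 (k - l)).

Definition depth (k : nat) : nat := count (on_stack k) (iota 0 k.+1).

Lemma on_stackP k l :
  reflect (forall m, l < m -> m <= k -> lt m l) (on_stack k l).
Proof.
apply: (iffP allP) => [h m lm mk|h m]; first by apply: h; rewrite mem_iota; lia.
by rewrite mem_iota => hm; apply: h; lia.
Qed.

Lemma depthE k : depth k = (count (on_stack k) (iota 0 k)).+1.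
Proof.
rewrite /depth -[k.+1]addn1 iotaD count_cat /= addn0.
have -> : on_stack k (0 + k) by apply/on_stackP => m; lia.
by rewrite addn1.
Qed.

Lemma depth_gt0 k : 0 < depth k.
Proof. by rewrite depthE. Qed.

Lemma depth_le_size k : depth k <= k.+1.
Proof. by rewrite -[k.+1](size_iota 0) count_size. Qed.

Lemma depthS k : depth k.+1 <= (depth k).+1.
Proof.
rewrite /depth -[k.+2]addn1 iotaD count_cat -[(count _ _).+1]addn1.
apply: leq_add; last by rewrite /= addn0 leq_b1.
by apply: sub_count => l /on_stackP h; apply/on_stackP => m lm mk; apply: h;
  lia.
Qed.

(** Pushing [l] pops everything from [k] on, so whatever is left below [l] was already on the stack
    below [k]. *)
Lemma depth_ge k l : k <= l -> (forall m, k <= m -> m < l -> lt m l) ->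
  depth l <= depth k.
Proof.
move=> kl dom; rewrite !depthE ltnS -{2}(subnKC kl) iotaD count_cat add0n.
rewrite [X in _ + X](_ : _ = 0) ?addn0.
  apply: sub_count => e /on_stackP h.
  by apply/on_stackP => m em mk; apply: h => //; lia.
apply/eqP; rewrite -leqn0 leqNgt -has_count; apply/hasPn => e.
rewrite mem_iota => /andP[ke el]; apply/on_stackP => /(_ l).
have el' : e < l by lia.
move=> /(_ el' (leqnn _)) le; have := lt_trans le (dom e ke el').
by rewrite lt_irr.
Qed.

(** Neither [k] nor anything below it is popped up to time [l], and [l] itself lies on top. *)
Lemma depth_gt k l : k < l -> (forall m, k < m -> m <= l -> lt m k) ->
  depth k < depth l.
Proof.
move=> kl dom; rewrite [depth l]depthE ltnS -{2}(subnKC kl) iotaD count_cat.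
apply: (@leq_trans (count (on_stack l) (iota 0 k.+1))); last first.
  by rewrite leq_addr.
rewrite /depth -!size_filter; apply: uniq_leq_size.
  by rewrite filter_uniq ?iota_uniq.
move=> e; rewrite !mem_filter mem_iota => /andP[/on_stackP h ek].
rewrite ek andbT; apply/on_stackP => m em ml.
have [mk|km] := leqP m k; first exact: h.
have [ek'|ke] := ltnP e k; last by rewrite (_ : e = k); [apply: dom|lia].
by apply: lt_trans (dom m km ml) _; apply: h.
Qed.

Definition popped (k : nat) : nat := k.+1 - depth k.

Lemma popped0 : popped 0 = 0.
Proof. by rewrite /popped; have := depth_gt0 0; lia. Qed.

Lemma poppedS_lt k : lt k k.+1 -> popped k < popped k.+1.
Proof.
move=> h; have : depth k.+1 <= depth k.
  by apply: depth_ge => // m km mk; have -> : m = k by lia.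
rewrite /popped; have := depth_le_size k; have := depth_le_size k.+1; lia.
Qed.

Lemma poppedS_gt k : ~~ lt k k.+1 -> popped k.+1 = popped k.
Proof.
move=> h; have : depth k < depth k.+1.
  apply: depth_gt => // m km mk; have -> : m = k.+1 by lia.
  by have /orP[|//] := lt_total (negbT (gtn_eqF (ltnSn k))); rewrite ?(negPf h).
have := depthS k; have := depth_le_size k; rewrite /popped; lia.
Qed.

Definition is_max (i j l : nat) : Prop :=
  i <= l <= j /\ forall k, i <= k <= j -> k != l -> lt k l.

Lemma ex_max i j : i <= j -> exists l, is_max i j l.
Proof.
move=> ij; rewrite -(subnKC ij); elim: (j - i) => [|d [l [lij lmax]]].
  by exists i; split=> [|k kij]; [lia|rewrite (_ : k = i) ?eqxx //; lia].
have : l != i + d.+1 by lia.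
move=> /lt_total /orP[h|h]; [exists (i + d.+1)|exists l]; split; try lia.
- move=> k kij knl; have [->//|knl'] := eqVneq k l.
  by apply: lt_trans h; apply: lmax => //; lia.
- move=> k kij knl; have [->//|kn] := eqVneq k (i + d.+1).
  by apply: lmax => //; lia.
Qed.

Lemma max_is_best i j l : is_max i j l ->
  is_best popped (fun k => i <= k <= j) l.
Proof.
move=> [lij lmax]; split=> // k kij; rewrite /wins /popped.
have := depth_le_size k; have := depth_le_size l.
have [kl|lk|->] := ltngtP k l; last by lia.
- have : depth l <= depth k; last by lia.
  by apply: depth_ge (ltnW kl) _ => m km ml; apply: lmax; lia.
- have : depth l < depth k; last by lia.
  by apply: depth_gt lk _ => m km ml; apply: lmax; lia.
Qed.

(** The range has a maximum, it is best by [max_is_best], and the best position is unique. *)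
Lemma best_is_max X n i j l : (forall k, k < n -> X k = popped k) ->
  i <= j -> j < n -> is_best X (fun k => i <= k <= j) l -> is_max i j l.
Proof.
move=> Xp ij jn [lij bl]; have [l' ml'] := ex_max ij.
suff -> : l = l' by [].
apply: (is_best_uniq (X := popped)) (max_is_best ml'); split=> // k kij.
by move: (bl k kij); rewrite /wins !Xp //; lia.
Qed.

End Stack.

(** Passing from [l] to [l.+1] pops from the stack of maxima if the new entry is larger ([U l]), and
    from the stack of minima otherwise; the other stack only grows. *)
Lemma pops_encoding (lt : rel nat) (n : nat) :
  irreflexive lt -> transitive lt ->
  (forall k l, k != l -> lt k l || lt l k) ->
  exists (U : nat -> bool) (y : nat -> nat),
    [/\ forall N, \sum_(l < N) y l <= n,
      forall s k, k < n -> pops U y s k <= k &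
    forall s i j m, i <= j -> j < n ->
      is_best (pops U y s) (fun k => i <= k <= j) m ->
      is_max (if s then lt else fun k l => lt l k) i j m].
Proof.
move=> irr tr tot; pose gt k l := lt l k.
have girr : irreflexive gt by move=> k; apply: irr.
have gtr : transitive gt by move=> k l m /[swap]; apply: tr.
have gtot k l : k != l -> gt k l || gt l k by rewrite orbC; apply: tot.
have asym k l : k != l -> gt k l = ~~ lt k l.
  move=> kl; apply/idP/idP => [h|/negPf h].
    by apply/negP => /(tr _ _ _ h); rewrite irr.
  by have := tot _ _ kl; rewrite h.
have asymS k : gt k k.+1 = ~~ lt k k.+1 by apply: asym; lia.
pose U l := lt l l.+1.
pose x s l := popped (if s then lt else gt) l.+1 - popped (if s then lt else
  gt) l.
(* Zero past the end of the array, so that the sum stays bounded for every [N], including the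
   padding of the last block. *)
pose y l := if l.+1 < n then (x (U l) l).-1 else 0.
exists U, y.
have popsE s k : k < n -> pops U y s k = popped (if s then lt else gt) k.
  elim: k => [|k IH] kn; first by rewrite /pops big_ord0 popped0.
  rewrite /pops big_ord_recr /= -/(pops _ _ _ _) IH ?(ltnW kn) // /y kn /x.
  have [Uk|Uk] := boolP (U k).
    case: s {IH} => /=; first by have := poppedS_lt irr tr Uk; lia.
    by rewrite addn0 (poppedS_gt gtr gtot) // asymS negbK.
  case: s {IH} => /=; first by rewrite addn0 (poppedS_gt tr tot).
  have : gt k k.+1 by rewrite asymS.
  by move=> /(poppedS_lt girr gtr); lia.
have popped_le lt' k : popped lt' k <= k.
  by have := depth_gt0 lt' k; rewrite /popped; lia.
split=> [N| |].
- case: n @y popsE => [|n] y popsE; first by rewrite big1 // => l _; rewrite /y.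
  (* Here [n] counts steps, one less than the entries. Each step contributes to exactly one stack,
     and each stack loses at most [n] elements. *)
  have sumn : \sum_(l < n) (y l).+1 = pops U y true n + pops U y false n.
    rewrite /pops -big_split /=; apply: eq_bigr => l _.
    by case: (U l); rewrite ?addn0.
  have le2 : \sum_(l < n) (y l).+1 <= n + n.
    by rewrite sumn !popsE //; apply: leq_add; apply: popped_le.
  have {}le2 : \sum_(l < n) y l <= n.
    move: le2; under eq_bigr => l _ do rewrite -addn1.
    by rewrite big_split /= sum_nat_const card_ord muln1 leq_add2r.
  apply: leq_trans (leq_trans le2 (leqnSn n)).
  have [Nn|nN] := leqP N n.
    by rewrite -(subnKC Nn) big_split_ord /= leq_addr.
  rewrite -(subnKC (ltnW nN)) big_split_ord /= [X in _ + X]big1 ?addn0 //.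
  by move=> l _; rewrite /y ltnS ltnNge leq_addr.
- by move=> s k kn; rewrite popsE.
- move=> s i j m ij jn; case: s.
  + exact: (best_is_max irr tr tot (popsE true) ij jn).
  + exact: (best_is_max girr gtr gtot (popsE false) ij jn).
Qed.

(** * Blocks and their codes *)

Fixpoint best_from (X : nat -> nat) (a d : nat) : nat :=
  if d is e.+1 then
    if wins X (best_from X a e) (a + d) then best_from X a e else a + d
  else a.

Lemma best_fromP X a d : is_best X (fun k => a <= k <= a + d) (best_from X a d).
Proof.
elim: d => [|d IH] /=.
  by split=> [|k kd]; [lia|rewrite (_ : k = a) /wins; lia].
have one : is_best X (pred1 (a + d.+1)) (a + d.+1).
  by split=> [|k /eqP ->]; rewrite /= ?eqxx // /wins; lia.
by apply: is_best_eq (is_best_merge IH one) => k /=; lia.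
Qed.

Lemma is_best_shift X Y (p : pred nat) q x m : (forall k,
  p k -> X (q + k) = x + Y k) ->
  is_best Y p m -> is_best X (fun k => (q <= k) && p (k - q)) (q + m).
Proof.
move=> XY [pm bm]; split=> [|k /andP[qk pk]]; first by rewrite leq_addr addKn.
by move: (bm _ pk); rewrite /wins -{3 4 5}(subnKC qk) !XY //; lia.
Qed.

Lemma popsS U y s k :
  pops U y s k.+1 = pops U y s k + (if U k == s then (y k).+1 else 0).
Proof. by rewrite /pops big_ord_recr. Qed.

Lemma popsD U y s q a :
  pops U y s (q + a) =
  pops U y s q + pops (fun t => U (q + t)) (fun t => y (q + t)) s a.
Proof. by rewrite /pops big_split_ord. Qed.

Lemma eq_pops U U' y y' s a : (forall t, t < a -> U t = U' t /\ y t = y' t) ->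
  pops U y s a = pops U' y' s a.
Proof. by move=> e; apply: eq_bigr => t _; have [-> ->] := e t (ltn_ord t). Qed.

Lemma pops_mono U y s k l : k <= l -> pops U y s k <= pops U y s l.
Proof. by move=> kl; rewrite -(subnKC kl) popsD leq_addr. Qed.

(** * Clipping large numbers of pops *)

Section Clip.
Variables (U : nat -> bool) (y : nat -> nat) (C : nat).

Definition clip (l : nat) : nat := minn (y l) C.

(** A counted step pops more than [C] elements even after clipping; a step that is not counted is
    unchanged by it. *)
Definition bigs (s : bool) (k : nat) : nat :=
  \sum_(l < k) ((U l == s) && (C <= y l)).

Lemma bigsS s k : bigs s k.+1 = bigs s k + ((U k == s) && (C <= y k)).
Proof. by rewrite /bigs big_ord_recr. Qed.

Lemma bigs_mono s k l : k <= l -> bigs s k <= bigs s l.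
Proof.
by move=> kl; rewrite -(subnKC kl) /bigs big_split_ord /= leq_addr.
Qed.

Lemma bigs_bound s k : bigs s k * C <= \sum_(l < k) y l.
Proof.
rewrite /bigs big_distrl /=; apply: leq_sum => l _.
by case: (_ == _); case: (leqP C (y l)) => h; rewrite /= ?mul1n ?mul0n.
Qed.

Lemma pops_clip_bigs s k l : k <= l -> bigs s k = bigs s l ->
  pops U y s k + pops U clip s l = pops U y s l + pops U clip s k.
Proof.
move=> kl; rewrite -(subnKC kl); elim: (l - k) => [|d IH].
  by rewrite addn0 addnC.
rewrite addnS !popsS bigsS => e.
have e' : bigs s k = bigs s (k + d).
  by have := @bigs_mono s k (k + d) (leq_addr _ _); lia.
have yc : clip (k + d) = minn (y (k + d)) C by [].
move: (IH e') e; rewrite -e'; have [_|_] := eqVneq (U (k + d)) s => /=;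
  last by lia.
by case: (leqP C (y (k + d))) => /=; lia.
Qed.

Lemma pops_clip_le s k l : k <= l -> bigs s k < bigs s l ->
  C < pops U y s l - pops U y s k /\ C < pops U clip s l - pops U clip s k.
Proof.
move=> kl; rewrite -(subnKC kl); elim: (l - k) => [|d IH].
  by rewrite addn0 ltnn.
have m1 := @pops_mono U y s k (k + d) (leq_addr _ _).
have m2 := @pops_mono U clip s k (k + d) (leq_addr _ _).
have yc : clip (k + d) = minn (y (k + d)) C by [].
rewrite addnS !popsS bigsS => e; move: IH e.
have [b IH _|b _] := ltnP (bigs s k) (bigs s (k + d)).
  by have [] := IH isT; case: (_ == _); split; lia.
by case: (U _ == _) => /=; case: (leqP C (y (k + d))) => /= hy; lia.
Qed.

(* A clipped step still pops more than C elements, which outweighs the at most *)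
(* C pushes between m and k.                                                   *)
Lemma wins_clip s m k : m <= k + C -> k <= m + C ->
  wins (pops U clip s) m k = wins (pops U y s) m k.
Proof.
have key a d : d <= C ->
    (a + d + pops U clip s a <= a + pops U clip s (a + d)) =
    (a + d + pops U y s a <= a + pops U y s (a + d)).
  move=> dC; have ad := leq_addr d a.
  have m1 := @pops_mono U y s _ _ ad; have m2 := @pops_mono U clip s _ _ ad.
  have := @bigs_mono s _ _ ad; rewrite leq_eqVlt => /orP[/eqP|] h.
    by have := pops_clip_bigs ad h; lia.
  by have := pops_clip_le ad h; lia.
move=> mk km; rewrite /wins; have [mlk|klm|->] := ltngtP m k.
- by have := key m (k - m); rewrite subnKC ?(ltnW mlk) //; lia.
- by have := key k (m - k); rewrite subnKC ?(ltnW klm) //; lia.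
- by rewrite !addn0 !leqnn.
Qed.

(* The pops lost by clipping before position k depend only on the number r of  *)
(* clipped steps before k.                                                     *)
Definition excess (n : nat) (s : bool) (r : nat) : nat :=
  let k := find (fun k => bigs s k == r) (iota 0 n.+1) in
  pops U y s k - pops U clip s k.

Lemma pops_clip_leq s k : pops U clip s k <= pops U y s k.
Proof.
apply: leq_sum => l _; case: (_ == _) => //.
by rewrite ltnS /clip geq_minl.
Qed.

(** [excess] measures the loss at the first position with the same number of clipped steps; from
    there to [k] nothing further is lost, by [pops_clip_bigs]. *)
Lemma pops_excess n s k : k <= n ->
  pops U y s k = pops U clip s k + excess n s (bigs s k).
Proof.
move=> kn; rewrite /excess; set h := find _ _.
have hk : has (fun l => bigs s l == bigs s k) (iota 0 n.+1).
  by apply/hasP; exists k; rewrite ?mem_iota //=; lia.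
have hn : h < n.+1 by move: hk; rewrite has_find size_iota.
have := nth_find 0 hk; rewrite -/h nth_iota // add0n => /eqP hb.
have := pops_clip_leq s h; have := pops_clip_leq s k.
have [kh|/ltnW kh] := leqP k h.
  by have := pops_clip_bigs kh (esym hb); lia.
by have := pops_clip_bigs kh hb; lia.
Qed.

End Clip.

Definition item := (bool * nat)%type.

Definition unary_code (c : seq item) : seq bool :=
  flatten [seq p.1 :: nseq p.2 true ++ [:: false] | p <- c].

Definition fixed_code (v : nat) (c : seq item) : seq bool :=
  flatten [seq p.1 :: mkseq (bit p.2) v | p <- c].

(* The leading bit tells the two encodings apart, which keeps codes injective. *)
Definition code (b v : nat) (c : seq item) : seq bool :=
  if size (unary_code c) < b then false :: unary_code c
  else true :: fixed_code v c.

Lemma size_unary_code c : size (unary_code c) = \sum_(p <- c) (p.2 + 2).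
Proof.
elim: c => [|p c IH]; first by rewrite big_nil.
rewrite /unary_code /= size_cat -/(unary_code c) IH big_cons.
by rewrite size_cat size_nseq /=; lia.
Qed.

Lemma size_fixed_code v c : size (fixed_code v c) = size c * v.+1.
Proof.
elim: c => [|p c IH] //.
by rewrite /fixed_code /= size_cat -/(fixed_code v c) IH size_mkseq; lia.
Qed.

Lemma size_code_max b v c : size c * v.+1 < b -> size (code b v c) <= b.
Proof. by rewrite /code; case: ifP => //= _; rewrite size_fixed_code. Qed.

(** The fixed-width code is used only when the unary one has at least [b] bits, and then it is
    shorter. A block thus costs at most one bit beyond its unary code, which preserves the bound
    [3 n]. *)
Lemma size_code_unary b v c : size c * v.+1 < b ->
  size (code b v c) <= (size (unary_code c)).+1.
Proof.
rewrite /code; case: (ltnP (size (unary_code c)) b) => //= h1 h2;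
  rewrite size_fixed_code ltnS.
by apply: leq_trans h1; apply: ltnW.
Qed.

Lemma unary_code_inj c c' : unary_code c = unary_code c' -> c = c'.
Proof.
elim: c c' => [|[u x] c IH] [|[u' x'] c'] //.
rewrite /unary_code /= -/(unary_code c) -/(unary_code c') => -[-> e].
suff [-> /IH -> //] : x = x' /\ unary_code c = unary_code c'.
elim: x x' e => [|x IHx] [|x'] //= [] // e.
by have [-> ->] := IHx _ e.
Qed.

Lemma bit_inj v x x' : x < 2 ^ v -> x' < 2 ^ v ->
  mkseq (bit x) v = mkseq (bit x') v -> x = x'.
Proof.
move=> xv xv' e; rewrite -(modn_small xv) -(modn_small xv') -!digits_bits.
apply: eq_digits => t tv; have := congr1 (fun z => nth false z t) e.
by rewrite !nth_mkseq // => ->.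
Qed.

Lemma fixed_code_inj v c c' : all (fun p => p.2 < 2 ^ v) c ->
  all (fun p => p.2 < 2 ^ v) c' -> size c = size c' ->
  fixed_code v c = fixed_code v c' -> c = c'.
Proof.
elim: c c' => [|[u x] c IH] [|[u' x'] c'] //= /andP[xv cv] /andP[xv' cv'] [sc].
rewrite /fixed_code /= -/(fixed_code v c) -/(fixed_code v c') => -[-> /eqP].
rewrite eqseq_cat ?size_mkseq // => /andP[/eqP/(bit_inj xv xv') -> /eqP].
by move=> /IH ->.
Qed.

Lemma code_inj b v c c' : all (fun p => p.2 < 2 ^ v) c ->
  all (fun p => p.2 < 2 ^ v) c' -> size c = size c' ->
  code b v c = code b v c' -> c = c'.
Proof.
move=> cv cv' sc; rewrite /code; do 2 case: ifP => // _; move=> [].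
  exact: unary_code_inj.
exact: fixed_code_inj.
Qed.

(* Pairs the length of a code with its value, so that the decoding need not be *)
(* prefix-free.                                                                *)
Definition key (b : nat) (z : seq bool) : nat :=
  size z * 2 ^ b + digits 2 (nth false z) (size z).

Lemma key_lt b z : size z <= b -> key b z < b.+1 * 2 ^ b.
Proof.
move=> zb; rewrite /key; have := bits_digits_lt (nth false z) (size z).
have : 2 ^ size z <= 2 ^ b by rewrite leq_exp2l.
have := leq_mul zb (leqnn (2 ^ b)); lia.
Qed.

Lemma key_inj b z z' : size z <= b -> size z' <= b -> key b z = key b z' ->
  z = z'.
Proof.
move=> zb zb'; rewrite /key => e.
have lt x : size x <= b -> digits 2 (nth false x) (size x) < 2 ^ b.
  move=> xb; apply: leq_trans (bits_digits_lt _ _) _.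
  by rewrite leq_exp2l.
have p0 : 0 < 2 ^ b by rewrite expn_gt0.
have es : size z = size z'.
  have := congr1 (divn^~ (2 ^ b)) e.
  by rewrite !divnMDl // !divn_small ?lt // !addn0.
apply: (@eq_from_nth _ false) => // t tz.
have ed : digits 2 (nth false z) (size z) = digits 2 (nth false z') (size z').
  by move: e; rewrite es => /addnI.
have := congr1 (fun x => x %/ 2 ^ t %% 2) ed.
rewrite (digit_get (@bits_lt _ _)) // (digit_get (@bits_lt _ _)) -?es //.
by do 2 case: (nth _ _ _).
Qed.

Section Decode.
Variables (s C b v : nat).

Definition valid (c : seq item) : Prop := size c = s /\ all (fun p =>
  p.2 <= C) c.

(** Classical choice is harmless here: decoding is never executed, it only determines the contents
    of the lookup tables. *)
Definition decode (x : nat) : seq item :=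
  if pselect (exists c, valid c /\ key b (code b v c) = x) is left e
  then projT1 (cid e) else [::].

Lemma decodeK c : s * v.+1 < b -> C < 2 ^ v -> valid c ->
  decode (key b (code b v c)) = c.
Proof.
move=> sb Cv [sc cC]; rewrite /decode; case: pselect => [e|[]];
  last by exists c.
case: (cid e) => c' [[sc' cC'] ek] /=.
have lt (c0 : seq item) : all (fun p => p.2 <= C) c0 -> all (fun p =>
  p.2 < 2 ^ v) c0.
  by apply: sub_all => p pC; apply: leq_ltn_trans Cv.
apply: (code_inj (b := b) (lt _ cC') (lt _ cC)); first by rewrite sc'.
by apply: key_inj ek; apply: size_code_max; rewrite ?sc ?sc'.
Qed.

End Decode.

(** * Memory layout *)

(** The address of array [k]. It varies with [n] while the program does not, so [layout] starts with
    a header of these addresses, whose last cell is the end of the arrays. *)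
Definition offset (arrs : seq (seq nat)) (k : nat) : nat :=
  (size arrs).+1 + sumn (take k (shape arrs)).

Definition layout (arrs : seq (seq nat)) : seq nat :=
  mkseq (offset arrs) (size arrs).+1 ++ flatten arrs.

Lemma size_layout arrs : size (layout arrs) = offset arrs (size arrs).
Proof.
by rewrite size_cat size_mkseq size_flatten /offset take_oversize // size_map.
Qed.

Lemma layout_offset arrs k : k <= size arrs ->
  nth 0 (layout arrs) k = offset arrs k.
Proof. by move=> ks; rewrite nth_cat size_mkseq ltnS ks nth_mkseq. Qed.

Lemma layout_array arrs k a : a < size (nth [::] arrs k) ->
  offset arrs k + a < size (layout arrs) /\
  nth 0 (layout arrs) (offset arrs k + a) = nth 0 (nth [::] arrs k) a.
Proof.
move=> ak; rewrite size_cat size_mkseq /offset -!addnA ltn_add2l.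
rewrite flatten_shape_lt // nth_cat size_mkseq ltnNge leq_addr /= addKn.
by rewrite nth_flatten_shape.
Qed.

Lemma size_array_le arrs k : size (nth [::] arrs k) <= size (layout arrs).
Proof.
case e: (size (nth [::] arrs k)) => [//|a].
have ak : a < size (nth [::] arrs k) by rewrite e.
by have [] := layout_array ak; lia.
Qed.

Definition ArrE (k : nat) (e : expr) : expr := Fetch (Op OpAdd (Fetch (Lit k)) e).

(* [hi] and [lo] are the word index and the offset of a bit of the stream,    *)
(* whose first word has its address in cell k.                                *)
Definition StreamE (k : nat) (wE hi lo : expr) : expr :=
  let a := Op OpAdd (Fetch (Lit k)) hi in
  Op OpAdd (Op OpShr (Fetch a) lo)
    (Op OpShl (Fetch (Op OpAdd a (Lit 1))) (Op OpSub wE lo)).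

Section Layout.
Variables (w i j : nat) (arrs : seq (seq nat)) (st : seq bool).
Hypotheses (w_gt0 : 0 < w).
Hypothesis layout_lt : size (layout arrs) < 2 ^ w.

Local Notation mem_ := (memory_of_bits w (bits_of_words w (layout arrs) ++ st)).
Local Notation ev := (ev w mem_ i j).

Lemma header_lt k : k <= size arrs -> k < 2 ^ w.
Proof.
move=> ks; apply: leq_ltn_trans layout_lt.
by rewrite size_layout /offset; lia.
Qed.

Lemma ev_header k : k <= size arrs -> ev (Fetch (Lit k)) (offset arrs k).
Proof.
move=> ks; have m_lt := memory_of_bits_lt w (bits_of_words w (layout arrs) ++
  st).
have le : offset arrs k <= size (layout arrs).
  rewrite size_layout /offset leq_add2l [take (size arrs) _]take_oversize
    ?size_map //.
  by rewrite -{2}(cat_take_drop k (shape arrs)) sumn_cat leq_addr.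
have <- : mem_ k = offset arrs k.
  rewrite memory_of_words; last by rewrite size_layout /offset; lia.
  by rewrite layout_offset // modn_small //; lia.
by apply: ev_load => //; apply: ev_lit; apply: header_lt.
Qed.

Lemma ev_arr k e a x : k < size arrs -> a < size (nth [::] arrs k) ->
  nth 0 (nth [::] arrs k) a = x -> x < 2 ^ w -> ev e a -> ev (ArrE k e) x.
Proof.
move=> ks ak <- xw ea; have [lt eq] := layout_array ak.
have m_lt := memory_of_bits_lt w (bits_of_words w (layout arrs) ++ st).
have -> : nth 0 (nth [::] arrs k) a = mem_ (offset arrs k + a).
  by rewrite memory_of_words // eq modn_small.
apply: ev_load => //; apply: ev_add => //; last by lia.
by apply: ev_header; apply: ltnW.
Qed.

Lemma ev_stream wE hi lo a u : ev wE w -> ev hi a -> ev lo u -> u < w ->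
  size (layout arrs) + a.+1 < 2 ^ w ->
  ev (StreamE (size arrs) wE hi lo)
     (digits 2 (fun t => nth false st (a * w + u + t)) w).
Proof.
move=> ew ea eu uw lt.
have m_lt := memory_of_bits_lt w (bits_of_words w (layout arrs) ++ st).
have eb := ev_header (leqnn (size arrs)); rewrite -size_layout in eb.
have e1 : ev (Op OpAdd (Fetch (Lit (size arrs))) hi) (size (layout arrs) + a).
  by apply: ev_add => //; lia.
have e2 : ev (Op OpAdd (Op OpAdd (Fetch (Lit (size arrs))) hi) (Lit 1))
    (size (layout arrs) + a.+1).
  rewrite -[a.+1]addn1 addnA; apply: ev_add => //; last by lia.
  by apply: ev_lit; lia.
rewrite -unaligned_word // /StreamE -(memory_of_stream w (layout arrs) st a).
rewrite -(memory_of_stream w (layout arrs) st a.+1).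
apply: ev_add.
- by apply: ev_shr => //; apply: ev_load.
- apply: ev_shl; first exact: ev_load.
  by apply: ev_sub => //; apply: ltnW.
- by rewrite !memory_of_stream unaligned_word // bits_digits_lt.
Qed.

End Layout.

(** * The data structure and its queries *)

Declare Scope expr_scope.
Delimit Scope expr_scope with expr.
Bind Scope expr_scope with expr.
Notation "a + b" := (Op OpAdd a b) : expr_scope.
Notation "a - b" := (Op OpSub a b) : expr_scope.
Notation "a * b" := (Op OpMul a b) : expr_scope.
Notation "a %/ b" := (Op OpDiv a b) : expr_scope.
Notation "a %% b" := (Op OpMod a b) : expr_scope.
Notation "a < b" := (Op OpLt a b) : expr_scope.
Notation "'2^' a" := (Op OpShl (Lit 1) a) (at level 30) : expr_scope.

(* Array 0 holds w, s, G, f, kap, Q, N, b, where Q is the number of blocks, N  *)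
(* the number of superblocks, and kap fields of f bits are packed in a word;   *)
(* array 1 holds logarithms, arrays 2 to 5 locate the codes of the blocks, and *)
(* arrays 6 to 15 (minima) and 16 to 25 (maxima) are those of [stack_arrays].  *)
(* Cell 26 of the header holds the address of the first word after the arrays. *)
Definition ParamE (k : nat) : expr := ArrE 0 (Lit k).
Definition wE := ParamE 0.
Definition sE := ParamE 1.
Definition GE := ParamE 2.
Definition fE := ParamE 3.
Definition kapE := ParamE 4.
Definition QE := ParamE 5.
Definition NE := ParamE 6.
Definition bE := ParamE 7.

Definition PackedE (k : nat) (e : expr) : expr :=
  (Op OpShr (ArrE k (e %/ kapE)) (e %% kapE * fE) %% 2^ fE)%expr.

Definition LogE (e : expr) : expr := ArrE 1 e.

(** A full word is fetched at the start of the code, enough for at most [b < w] bits; the reduction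
    modulo [2 ^ len] removes what follows the code. *)
Definition KeyE (q : expr) : expr :=
  let offs := (ArrE 3 (q %/ GE) + PackedE 4 q)%expr in
  let hi := (ArrE 2 (q %/ GE) + offs %/ wE)%expr in
  let len := PackedE 5 q in
  (len * 2^ bE + StreamE 26 wE hi (offs %% wE) %% 2^ len)%expr.

Definition stack_index (u : bool) (k : nat) : nat := (if u then 16 else 6) + k.

Definition SumE (js jr jt : nat) (e : expr) : expr :=
  let q := (e %/ sE)%expr in
  (ArrE js (q %/ GE) + PackedE jr q + ArrE jt (KeyE q * sE + e %% sE))%expr.

Definition PopsE (u : bool) (e : expr) : expr :=
  let ix := stack_index u in
  (SumE (ix 0) (ix 2) (ix 7) e +
   ArrE (ix 4) (SumE (ix 1) (ix 3) (ix 8) e))%expr.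

(** Word subtraction wraps around, so the order of [k] and [l] is settled first; pop counts being
    monotone, the differences in the selected branch are then nonnegative. *)
Definition BetterE (u : bool) (k l : expr) : expr :=
  IfE (k < l)%expr
    (IfE (PopsE u l - PopsE u k < l - k)%expr k l)
    (IfE (PopsE u k - PopsE u l < k - l)%expr l k).

Definition BlockE (u : bool) (q a c : expr) : expr :=
  (q * sE + ArrE (stack_index u 9) ((KeyE q * sE + a) * sE + c))%expr.

Definition ShortE (u : bool) (l q : expr) : expr :=
  (q * sE + PackedE (stack_index u 5) (l * QE + q))%expr.

Definition LongE (u : bool) (l q : expr) : expr :=
  ArrE (stack_index u 6) (l * NE + q)%expr.

(** Where a piece of the range is empty, [first] takes its place: it is a candidate anyway, so
    comparing with it again changes nothing. *)
Definition QueryE (u : bool) (i j : expr) : expr :=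
  let qi := (i %/ sE)%expr in
  let qj := (j %/ sE)%expr in
  let first := BlockE u qi (i %% sE)
    (IfE (qi < qj)%expr (sE - Lit 1)%expr (j %% sE)%expr) in
  let last := IfE (qi < qj)%expr (BlockE u qj (Lit 0) (j %% sE)) first in
  let len := (qj - qi - Lit 1)%expr in
  let l := LogE (IfE (len < GE)%expr len GE) in
  let short := IfE (qi + Lit 1 < qj)%expr
    (BetterE u (ShortE u l (qi + Lit 1)) (ShortE u l (qj - 2^ l))) first in
  let pi := (qi %/ GE + Lit 1)%expr in
  let pj := (qj %/ GE)%expr in
  let h := LogE (pj - pi)%expr in
  let long := IfE (pi < pj)%expr
    (BetterE u (LongE u h pi) (LongE u h (pj - 2^ h))) first in
  BetterE u (BetterE u first last) (BetterE u short long).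

(** The reduction makes all fields fit without a condition on [g]; [ev_pack] requires [g a < 2 ^ f]
    only for the field that is read. *)
Definition pack (f kap : nat) (g : nat -> nat) (N : nat) : seq nat :=
  mkseq (fun p => digits (2 ^ f) (fun t => g (p * kap + t) %% 2 ^ f) kap)
    (N %/ kap).+1.

Definition item_pops (c : seq item) (u : bool) (a : nat) : nat :=
  pops (fun t => (nth (false, 0) c t).1) (fun t => (nth (false, 0) c t).2) u a.

Definition item_bigs (C : nat) (c : seq item) (u : bool) (a : nat) : nat :=
  bigs (fun t => (nth (false, 0) c t).1)
    (fun t => (nth (false, 0) c t).2) C u a.

Section Structure.
Variables (w n s b v lam f kap C : nat) (U : nat -> bool) (y : nat -> nat).

Let G := 2 ^ lam.
Let Q := n %/ s + 1.
Let N := Q %/ G + 1.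
Let NT := b.+1 * 2 ^ b.
Let X := pops U y.
Let XC := pops U (clip y C).
Let B := bigs U y C.

Definition block (q : nat) : seq item :=
  mkseq (fun t => (U (q * s + t), clip y C (q * s + t))) s.
Definition block_code (q : nat) : seq bool := code b v (block q).
Definition code_start (q : nat) : nat := \sum_(p < q) size (block_code p).
Definition stream : seq bool := flatten (mkseq block_code Q).

Definition pop_table (u : bool) : seq nat :=
  mkseq (fun z => item_pops (decode s C b v (z %/ s)) u (z %% s)) (NT * s).
Definition big_table (u : bool) : seq nat :=
  mkseq (fun z => item_bigs C (decode s C b v (z %/ s)) u (z %% s)) (NT * s).
Definition argmin_table (u : bool) : seq nat :=
  mkseq (fun z => let a := z %/ s %% s in
    best_from (item_pops (decode s C b v (z %/ s %/ s)) u) a (z %% s - a))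
    (NT * s * s).
(** Stored relative to the start of the window, so that [O(lg w)] bits suffice; [long_table] has few
    enough entries to afford full words. *)
Definition short_table (u : bool) : seq nat :=
  pack f kap (fun z => let q := z %% Q in
    best_from (X u) (q * s) (2 ^ (z %/ Q) * s).-1 - q * s) (lam.+1 * Q).
Definition long_table (u : bool) : seq nat :=
  mkseq (fun z => best_from (X u) (z %% N * G * s)
    (2 ^ (z %/ N) * G * s).-1) (w * N).

Definition stack_arrays (u : bool) : seq (seq nat) :=
  [:: mkseq (fun p => XC u (p * G * s)) N;
      mkseq (fun p => B u (p * G * s)) N;
      pack f kap (fun q => XC u (q * s) - XC u (q %/ G * G * s)) Q;
      pack f kap (fun q => B u (q * s) - B u (q %/ G * G * s)) Q;
      mkseq (excess U y C n u) (n %/ C).+1;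
      short_table u;
      long_table u;
      pop_table u;
      big_table u;
      argmin_table u].

Definition arrays : seq (seq nat) :=
  [:: [:: w; s; G; f; kap; Q; N; b];
      mkseq (trunc_log 2) (G + N).+1;
      mkseq (fun p => code_start (p * G) %/ w) N;
      mkseq (fun p => code_start (p * G) %% w) N;
      pack f kap (fun q => code_start q - code_start (q %/ G * G)) Q;
      pack f kap (fun q => size (block_code q)) Q] ++
  stack_arrays false ++ stack_arrays true.

Definition data : seq bool := bits_of_words w (layout arrays) ++ stream.

Lemma size_pack g M : size (pack f kap g M) = (M %/ kap).+1.
Proof. by rewrite size_mkseq. Qed.

Lemma size_layout_arrays :
  size (layout arrays) = 27 + (8 + ((G + N).+1 + (N + (N + ((Q %/ kap).+1 +
    ((Q %/ kap).+1 + 2 * (N + (N + ((Q %/ kap).+1 + ((Q %/ kap).+1 +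
    ((n %/ C).+1 + ((lam.+1 * Q %/ kap).+1 + (w * N + (NT * s + (NT * s +
    NT * s * s))))))))))))))).
Proof.
pose S := N + (N + ((Q %/ kap).+1 +
    ((Q %/ kap).+1 + ((n %/ C).+1 + ((lam.+1 * Q %/ kap).+1 + (w * N +
    (NT * s + (NT * s + NT * s * s)))))))).
have sA u : sumn (shape (stack_arrays u)) = S.
  rewrite /stack_arrays /shape !map_cons /pop_table /big_table /argmin_table.
  by rewrite /short_table /long_table !size_pack !size_mkseq /= addn0.
rewrite size_layout /offset take_oversize ?size_map // /shape !map_cat
  !sumn_cat.
rewrite -/(shape (stack_arrays true)) -/(shape (stack_arrays false)) !sA.
rewrite !map_cons !size_pack !size_mkseq -/S /=.
by clearbody S G N Q; clear; lia.
Qed.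

Lemma size_layout_arrays_le : 0 < s -> 0 < kap -> 0 < w ->
  size (layout arrays) <= 46 + G + 9 * (w * N) + 8 * (lam.+1 * Q %/ kap) +
    2 * (n %/ C) + 6 * (NT * s * s).
Proof.
move=> s0 kap0 w0; rewrite size_layout_arrays.
have h1 : NT * s <= NT * s * s by rewrite leq_pmulr.
have h2 : Q %/ kap <= lam.+1 * Q %/ kap by rewrite leq_div2r // leq_pmull.
have h3 : N <= w * N by rewrite leq_pmull.
move: (NT * s * s) (NT * s) (w * N) (Q %/ kap) (lam.+1 * Q %/ kap) h1 h2 h3.
by move: (n %/ C); clearbody G N; clear; lia.
Qed.

Lemma sum_blocks (g : nat -> nat) p :
  \sum_(q < p) \sum_(t < s) g (q * s + t) = \sum_(l < p * s) g l.
Proof.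
elim: p => [|p IH]; first by rewrite !big_ord0.
by rewrite big_ord_recr /= IH mulSnr big_split_ord.
Qed.

(** The error term [Q] pays for the leading bit of each block, and [2 * s] for the padding steps of
    the last block. *)
Lemma size_stream_le : s * v.+1 < b -> 0 < s ->
  (forall k, \sum_(l < k) y l <= n) -> size stream <= 3 * n + (2 * s + Q).
Proof.
move=> sb s0 ysum; rewrite /stream size_flatten /shape -map_comp sumnE big_map.
rewrite -[X in iota 0 X]subn0 -/(index_iota 0 Q) big_mkord.
apply: (@leq_trans (\sum_(q < Q) (1 + \sum_(t < s) (y (q * s + t) + 2)))).
  apply: leq_sum => q _ /=; apply: leq_trans (size_code_unary _) _.
    by rewrite size_mkseq.
  rewrite add1n ltnS size_unary_code /block /mkseq big_map.
  rewrite -[X in iota 0 X]subn0 -/(index_iota 0 s) big_mkord.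
  by apply: leq_sum => t _; rewrite leq_add2r geq_minl.
rewrite big_split /= sum_nat_const card_ord muln1.
rewrite (sum_blocks (fun l => y l + 2)) big_split /= sum_nat_const card_ord.
have := ysum (Q * s); have := leq_trunc_div n s.
set Sy := (\sum_(l < Q * s) y l);
  have : Q * s = n %/ s * s + s by rewrite mulnDl mul1n.
by move: (Q * s) (n %/ s * s); clearbody Q Sy; clear; lia.
Qed.

(** * Correctness of the queries *)

Hypotheses (n_lt : n < 2 ^ w) (s_gt0 : 0 < s) (s_b : s * v.+1 < b)
  (b_w : b < w) (kap_gt0 : 0 < kap) (kap_f : kap * f <= w) (f_w : f < w)
  (s_C : s <= C) (C_v : C < 2 ^ v) (Gs_f : G * s * C.+1 < 2 ^ f)
  (Gb_f : G * b < 2 ^ f) (lamQ : lam.+1 * Q < 2 ^ w)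
  (mem_lt : size (layout arrays) + (size stream %/ w).+1 < 2 ^ w)
  (y_sum : forall k, \sum_(l < k) y l <= n)
  (X_le : forall u k, k < n -> X u k <= k).

Variables (i j : nat).
Hypotheses (i_lt : i < 2 ^ w) (j_lt : j < 2 ^ w).

Local Notation ev := (ev w (memory_of_bits w data) i j).

Let w_gt0 : 0 < w. Proof. lia. Qed.
Let G_gt0 : 0 < G. Proof. by rewrite expn_gt0. Qed.
Let layout_lt : size (layout arrays) < 2 ^ w.
Proof. exact: leq_ltn_trans (leq_addr _ _) mem_lt. Qed.
Let m_lt := memory_of_bits_lt w data.

Let size_lt k : size (nth [::] arrays k) < 2 ^ w.
Proof. exact: leq_ltn_trans (size_array_le _ _) layout_lt. Qed.

Lemma stack_arrayE u k : k < 10 ->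
  nth [::] arrays (stack_index u k) = nth [::] (stack_arrays u) k.
Proof. by case: u; do 10 (case: k => [//|k]). Qed.

Let ev_small k : k < 26 -> ev (Lit k) k.
Proof. by move=> k26; apply: ev_lit;
  exact: (header_lt w_gt0 layout_lt (ltnW k26)). Qed.

Let ev_word (g : nat -> nat) M k e a : nth [::] arrays k = mkseq g M ->
  k < 26 -> a < M -> g a < 2 ^ w -> ev e a -> ev (ArrE k e) (g a).
Proof.
move=> ek k26 aM gw ea; apply: (ev_arr w_gt0 layout_lt _ _ _ _ ea) => //;
  rewrite ek.
- by rewrite size_mkseq.
- by rewrite nth_mkseq.
Qed.

Let Q_lt : Q < 2 ^ w.
Proof. by apply: leq_ltn_trans lamQ; rewrite leq_pmull. Qed.

Let N_lt : N < 2 ^ w.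
Proof. by have := size_lt 2; rewrite /= size_mkseq. Qed.

Let f_gt0 : 0 < f.
Proof. by case: f Gb_f => //; rewrite expn0 ltnS leqn0 muln_eq0; lia. Qed.


Let pow_lt k : k <= w -> k < w -> 2 ^ k < 2 ^ w.
Proof. by move=> _ kw; rewrite ltn_exp2l. Qed.

Let ev_param k : k < 8 -> ev (ParamE k) (nth 0 [:: w; s; G; f; kap; Q; N; b] k).
Proof.
move=> k8; apply: (ev_arr w_gt0 layout_lt (a := k)) => //;
  last by apply: ev_small; lia.
have ww : w < 2 ^ w by apply: ltn_expl.
have Gw : G < 2 ^ w.
  have : 2 ^ f < 2 ^ w by apply: pow_lt => //; apply: ltnW.
  by have : G <= G * b; [rewrite leq_pmulr; lia|lia].
have kw : kap <= kap * f by rewrite leq_pmulr.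
have ss : s <= s * v.+1 by rewrite leq_pmulr.
by do 8 (case: k k8 => [|k] k8; [rewrite /=; lia|]).
Qed.

Let ev_pow e k : k < w -> ev e k -> ev (2^ e)%expr (2 ^ k).
Proof.
move=> kw ek; rewrite -(modn_small (pow_lt (ltnW kw) kw)) -[X in X %% _]mul1n.
by apply: ev_shl => //; apply: ev_small.
Qed.

Let ev_pack (g : nat -> nat) M k e a : nth [::] arrays k = pack f kap g M ->
  k < 26 -> a < M -> g a < 2 ^ f -> ev e a -> ev (PackedE k e) (g a).
Proof.
move=> ek k26 aM gf ea; rewrite /PackedE.
have kapE_ := @ev_param 4 isT; have fE_ := @ev_param 3 isT.
have dlt p : digits (2 ^ f) (fun t => g (p * kap + t) %% 2 ^ f) kap < 2 ^ w.
  apply: (@leq_trans ((2 ^ f) ^ kap)).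
    by apply: digits_lt => t _; rewrite ltn_mod expn_gt0.
  by rewrite -expnM leq_exp2l // mulnC.
have -> : g a = digits (2 ^ f) (fun t => g (a %/ kap * kap + t) %% 2 ^ f) kap
    %/ 2 ^ (a %% kap * f) %% 2 ^ f.
  rewrite [a %% kap * f]mulnC expnM digit_get ?ltn_mod // -?divn_eq ?modn_small
    //.
  by move=> t _; rewrite ltn_mod expn_gt0.
apply: ev_mod; last exact: ev_pow.
apply: ev_shr.
  apply: (ev_word (g := fun p => digits _ (fun t =>
    g (p * kap + t) %% _) _) ek) => //.
    by rewrite ltnS; apply: leq_div2r; apply: ltnW.
  exact: ev_div.
apply: ev_mul => //; first exact: ev_mod.
apply: leq_ltn_trans (ltn_expl w (isT : 1 < 2)); apply: leq_trans kap_f.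
by rewrite leq_mul2r; apply/orP; right; apply: ltnW; rewrite ltn_mod.
Qed.

Lemma block_valid q : valid s C (block q).
Proof.
split; first by rewrite size_mkseq.
by apply/allP => _ /mapP[t _ ->]; rewrite /clip geq_minr.
Qed.

Lemma decode_block q : decode s C b v (key b (block_code q)) = block q.
Proof. exact: decodeK s_b C_v (block_valid q). Qed.

Lemma size_block_code q : size (block_code q) <= b.
Proof. by apply: size_code_max; rewrite size_mkseq. Qed.

Lemma code_startE q : q <= Q ->
  code_start q = sumn (take q (shape (mkseq block_code Q))).
Proof.
move=> qQ; rewrite /shape /mkseq -2!map_take take_iota.
rewrite (minn_idPl qQ) -map_comp sumnE big_map.
by rewrite /code_start -(big_mkord predT (fun p =>
  size (block_code p))) /index_iota subn0.
Qed.

Lemma code_start_mono : {homo code_start : p q / p <= q}.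
Proof.
by move=> p q pq; rewrite /code_start -(subnKC pq) big_split_ord /= leq_addr.
Qed.

Lemma nth_stream q t : q < Q -> t < size (block_code q) ->
  nth false stream (code_start q + t) = nth false (block_code q) t.
Proof.
move=> qQ tq; rewrite code_startE ?(ltnW qQ) //.
by rewrite nth_flatten_shape nth_mkseq.
Qed.

Lemma size_stream : size stream = code_start Q.
Proof.
rewrite /stream size_flatten code_startE // take_oversize //.
by rewrite size_map size_mkseq.
Qed.

Lemma slow_growth (F : nat -> nat) c k l : (forall k, F k.+1 <= F k + c) ->
  k <= l -> F l - F k <= (l - k) * c.
Proof.
move=> Fc kl; rewrite -(subnKC kl); elim: (l - k) => [|d IH].
  by rewrite addn0 subnn.
move: IH (Fc (k + d)); rewrite addnS addKn => IH h.
by rewrite (_ : (k + d).+1 - k = d.+1) ?mulSn; lia.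
Qed.

Lemma block_growth (F : nat -> nat) c q : (forall k, F k.+1 <= F k + c) ->
  F q - F (q %/ G * G) <= G * c.
Proof.
move=> Fc; apply: leq_trans (slow_growth Fc (leq_trunc_div q G)) _.
rewrite leq_mul2r; apply/orP; right.
by rewrite {1}(divn_eq q G) addKn ltnW // ltn_mod.
Qed.

Let w_f_le : w + 2 ^ f <= 2 ^ w.
Proof.
case: w f_w => // w' fw; rewrite expnS mul2n -addnn.
by apply: leq_add; [apply: ltn_expl|rewrite leq_exp2l].
Qed.

Lemma code_start_rel q : code_start q - code_start (q %/ G * G) < 2 ^ f.
Proof.
apply: leq_ltn_trans Gb_f; apply: block_growth => k.
by rewrite /code_start big_ord_recr leq_add2l size_block_code.
Qed.

Lemma ev_super e q : ev e q -> ev (e %/ GE)%expr (q %/ G).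
Proof. by move=> eq; apply: ev_div => //; apply: ev_param 2 isT. Qed.

Lemma super_lt q : q < Q -> q %/ G < N.
Proof. by move=> qQ; rewrite /N addn1 ltnS leq_div2r // ltnW. Qed.

Lemma ev_key e q : q < Q -> ev e q -> ev (KeyE e) (key b (block_code q)).
Proof.
move=> qQ eq; have eG := ev_super eq; have gN := super_lt qQ.
have ww := ltn_expl w (isT : 1 < 2).
have wE_ := @ev_param 0 isT; have bE_ := @ev_param 7 isT.
have bf : b < 2 ^ f.
  by apply: leq_ltn_trans Gb_f; rewrite leq_pmull.
have e5 : ev (PackedE 5 e) (size (block_code q)).
  apply: (ev_pack (g := fun q => size (block_code q)) (M := Q)) => //.
  by apply: leq_ltn_trans bf; apply: size_block_code.
have e4 := @ev_pack (fun q => code_start q - code_start (q %/ G * G)) Q 4 _ _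
  erefl isT qQ (code_start_rel q) eq.
have e3 : ev (ArrE 3 (e %/ GE)%expr) (code_start (q %/ G * G) %% w).
  apply: (@ev_word (fun p => code_start (p * G) %% w) N) => //.
  by apply: ltn_trans ww; rewrite ltn_mod.
have start_le : code_start (q %/ G * G) <= code_start q.
  by apply: code_start_mono; apply: leq_trunc_div.
have word_le : code_start q %/ w <= size stream %/ w.
  by rewrite size_stream leq_div2r // code_start_mono // ltnW.
have word_lt : size (layout arrays) + (code_start q %/ w).+1 < 2 ^ w.
  by apply: leq_ltn_trans mem_lt; rewrite leq_add2l ltnS.
have e2 : ev (ArrE 2 (e %/ GE)%expr) (code_start (q %/ G * G) %/ w).
  apply: (@ev_word (fun p => code_start (p * G) %/ w) N) => //.
  apply: leq_ltn_trans (leq_div2r w start_le) _.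
  by apply: leq_ltn_trans word_lt; rewrite addnS ltnW // ltnS leq_addl.
set offs := code_start (q %/ G * G) %% w +
  (code_start q - code_start (q %/ G * G)).
have eoffs : ev (ArrE 3 (e %/ GE) + PackedE 4 e)%expr offs.
  apply: ev_add => //; apply: leq_trans w_f_le; rewrite /offs -addnS.
  exact: leq_add (ltnW (ltn_pmod _ w_gt0)) (code_start_rel q).
have startE : code_start q = code_start (q %/ G * G) %/ w * w + offs.
  by rewrite /offs addnA -divn_eq subnKC.
have div_start : code_start q %/ w = code_start (q %/ G * G) %/ w + offs %/ w.
  by rewrite startE divnMDl.
have mod_start : code_start q %% w = offs %% w.
  by rewrite startE modnMDl.
have ehi : ev (ArrE 2 (e %/ GE) + (ArrE 3 (e %/ GE) + PackedE 4 e) %/ wE)%expr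
    (code_start q %/ w).
  rewrite div_start; apply: ev_add => //; first exact: ev_div.
  by rewrite -div_start; apply: leq_ltn_trans word_lt;
    rewrite addnS ltnW // ltnS leq_addl.
have elo : ev ((ArrE 3 (e %/ GE) + PackedE 4 e) %% wE)%expr (code_start q %% w).
  by rewrite mod_start; apply: ev_mod.
have lenw : size (block_code q) < w.
  exact: leq_ltn_trans (size_block_code q) b_w.
have kE : key b (block_code q) = size (block_code q) * 2 ^ b +
    digits 2 (fun t => nth false stream
      (code_start q %/ w * w + code_start q %% w + t)) w
      %% 2 ^ size (block_code q).
  rewrite /key digits_modn ?(ltnW lenw) //; last by move=> t _;
    case: (nth _ _ _).
  congr (_ + _); apply: eq_digits => t tl.
  by rewrite -divn_eq nth_stream.
have key_lt_ : key b (block_code q) < 2 ^ w.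
  apply: leq_trans (key_lt (size_block_code q)) _.
  (* Array 13 is [pop_table false]; its [NT * s] entries are addressable and [NT] bounds the
     keys. *)
  apply: ltnW; apply: leq_ltn_trans (size_lt 13).
  by rewrite /= size_mkseq leq_pmulr.
rewrite kE; apply: ev_add; last by rewrite -kE.
  apply: ev_mul => //; first exact: ev_pow.
  by apply: leq_ltn_trans key_lt_; rewrite /key leq_addr.
apply: ev_mod; last exact: ev_pow.
by apply: (ev_stream w_gt0 layout_lt wE_ ehi elo) => //; rewrite ltn_mod.
Qed.

Lemma super_rel_lt (F : nat -> nat) q : (forall k, F k.+1 <= F k + C.+1) ->
  F (q * s) - F (q %/ G * G * s) < 2 ^ f.
Proof.
move=> FC; apply: leq_ltn_trans Gs_f; rewrite -(mulnA G).
apply: (@block_growth (fun q => F (q * s)) (s * C.+1) q) => k.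
have ks : k * s <= k.+1 * s by rewrite mulSn leq_addl.
have := slow_growth FC ks; rewrite leq_subLR.
by rewrite (_ : k.+1 * s - k * s = s) // mulSn addnK.
Qed.

Lemma block_lt k : k < n -> k %/ s < Q.
Proof. by move=> kn; rewrite /Q addn1 ltnS leq_div2r // ltnW. Qed.

Let ev_s : ev sE s. Proof. exact: (@ev_param 1 isT). Qed.

Let key_idx q t : t < s -> key b (block_code q) * s + t < NT * s.
Proof.
move=> ts; apply: (@leq_trans ((key b (block_code q)).+1 * s)).
  by rewrite mulSn addnC ltn_add2r.
by rewrite leq_mul2r (key_lt (size_block_code q)) orbT.
Qed.

(** Generic in the prefix sum [F], as it serves both the clipped pop counts and the numbers of
    clipped steps. *)
Lemma ev_sum (F : nat -> nat) (T : seq item -> nat -> nat) js jr jt e k :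
  js < 26 -> jr < 26 -> jt < 26 ->
  nth [::] arrays js = mkseq (fun p => F (p * G * s)) N ->
  nth [::] arrays jr =
    pack f kap (fun q => F (q * s) - F (q %/ G * G * s)) Q ->
  nth [::] arrays jt =
    mkseq (fun z => T (decode s C b v (z %/ s)) (z %% s)) (NT * s) ->
  {homo F : p q / p <= q} -> (forall k, F k.+1 <= F k + C.+1) ->
  (forall q t, t < s -> F (q * s + t) = F (q * s) + T (block q) t) ->
  k < n -> F k < 2 ^ w -> ev e k -> ev (SumE js jr jt e) (F k).
Proof.
move=> js26 jr26 jt26 ejs ejr ejt F_mono F_slow F_block kn Fw ek.
have eq : ev (e %/ sE)%expr (k %/ s) by apply: ev_div.
have et : ev (e %% sE)%expr (k %% s) by apply: ev_mod.
have qQ := block_lt kn; set q := k %/ s in eq qQ *.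
have ts : k %% s < s by rewrite ltn_mod.
have Fk : F k = F (q %/ G * G * s) + (F (q * s) - F (q %/ G * G * s)) +
    T (block q) (k %% s).
  rewrite subnKC; first by rewrite -F_block // -divn_eq.
  by apply: F_mono; rewrite leq_mul2r leq_trunc_div orbT.
rewrite Fk; have Fk1 : F (q %/ G * G * s) + (F (q * s) - F (q %/ G * G * s)) <
  2 ^ w.
  by apply: leq_ltn_trans Fw; rewrite Fk leq_addr.
apply: ev_add; last by rewrite -Fk.
  apply: ev_add => //.
    apply: (ev_word ejs js26 (super_lt qQ)); last exact: ev_super.
    by apply: leq_ltn_trans Fk1; rewrite leq_addr.
  exact: (ev_pack ejr jr26 qQ (super_rel_lt _ F_slow) eq).
have -> : T (block q) (k %% s) =
    (fun z => T (decode s C b v (z %/ s)) (z %% s))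
    (key b (block_code q) * s + k %% s).
  by rewrite /= divnMDl // divn_small // addn0 decode_block modnMDl modn_mod.
have idx := key_idx q ts.
have idxw : key b (block_code q) * s + k %% s < 2 ^ w.
  by apply: ltn_trans (size_lt jt); rewrite ejt size_mkseq.
apply: (ev_word ejt jt26 idx).
  rewrite /= divnMDl // divn_small // addn0 decode_block modnMDl modn_mod.
  by apply: leq_ltn_trans Fw; rewrite Fk leq_addl.
apply: ev_add => //; apply: ev_mul => //; first exact: ev_key.
by apply: leq_ltn_trans idxw; rewrite leq_addr.
Qed.

Lemma item_popsE u q t : t <= s ->
  XC u (q * s + t) = XC u (q * s) + item_pops (block q) u t.
Proof.
move=> ts; rewrite /XC popsD; congr (_ + _); apply: eq_pops => a at_.
by rewrite nth_mkseq //; apply: leq_trans ts.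
Qed.

Lemma item_bigsE u q t : t <= s ->
  B u (q * s + t) = B u (q * s) + item_bigs C (block q) u t.
Proof.
move=> ts; rewrite /B /bigs big_split_ord; congr (_ + _).
apply: eq_bigr => a _ /=; rewrite nth_mkseq; last exact: leq_trans ts.
by rewrite /= /clip leq_min leqnn andbT.
Qed.

Lemma X_lt u k : k < n -> X u k < 2 ^ w.
Proof. by move=> kn; apply: leq_ltn_trans (X_le u kn) (ltn_trans kn n_lt). Qed.

Lemma bigs_le u k : B u k <= k.
Proof.
rewrite /B /bigs; apply: leq_trans (_ : \sum_(l < k) 1 <= k).
  by apply: leq_sum => l _; apply: leq_b1.
by rewrite sum_nat_const card_ord muln1.
Qed.

Lemma ev_pops u e k : k < n -> ev e k -> ev (PopsE u e) (X u k).
Proof.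
move=> kn ek; rewrite /X (pops_excess U y C u (ltnW kn)).
have ix c : c < 10 -> stack_index u c < 26 by case: u => /=;
  rewrite /stack_index; lia.
have Xlt := X_lt u kn; rewrite /X (pops_excess U y C u (ltnW kn)) in Xlt.
have Blt : B u k < 2 ^ w
  by apply: leq_ltn_trans (bigs_le u k) (ltn_trans kn n_lt).
apply: ev_add => //.
- apply: (@ev_sum (XC u) (fun c => item_pops c u));
    rewrite ?stack_arrayE ?ix //.
  + by move=> p q pq; apply: pops_mono.
  + by move=> l; rewrite /XC popsS leq_add2l; case: ifP => // _;
    rewrite ltnS geq_minr.
  + by move=> q t /ltnW; apply: item_popsE.
  + by apply: leq_ltn_trans Xlt; rewrite leq_addr.
- apply: (ev_word (g := excess U y C n u) (M := (n %/ C).+1)).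
  + by rewrite stack_arrayE.
  + exact: ix.
  + rewrite ltnS leq_divRL; last by apply: leq_trans s_C.
    by apply: leq_trans (bigs_bound U y C u k) _.
  + by apply: leq_ltn_trans Xlt; rewrite leq_addl.
  + apply: (@ev_sum (B u) (fun c => item_bigs C c u));
    rewrite ?stack_arrayE ?ix //.
    * by move=> p q pq; apply: bigs_mono.
    * by move=> l; rewrite /B bigsS leq_add2l; case: (_ && _).
    * by move=> q t /ltnW; apply: item_bigsE.
Qed.

Let ev_ite := ev_if w_gt0 i_lt j_lt m_lt.

Lemma ev_better u ek el k l : k < n -> l < n -> ev ek k -> ev el l ->
  ev (BetterE u ek el) (if wins (X u) k l then k else l).
Proof.
move=> kn ln evk evl; have pk := ev_pops u kn evk; have pl := ev_pops u ln evl.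
rewrite /BetterE; apply: ev_ite.
- by apply: (ev_lt w_gt0); [exact: evk|exact: evl].
- move=> kl; have Xkl : X u k <= X u l by apply: pops_mono; apply: ltnW.
  apply: ev_ite.
  + apply: (ev_lt w_gt0).
      exact: ev_sub pl pk Xkl.
    exact: ev_sub evl evk (ltnW kl).
  + by move=> h; rewrite ifT // /wins; clear -h kl Xkl; lia.
  + by move=> h; rewrite ifF // /wins; clear -h kl Xkl; lia.
- rewrite -leqNgt => lk; have Xlk : X u l <= X u k by apply: pops_mono.
  apply: ev_ite.
  + apply: (ev_lt w_gt0).
      exact: ev_sub pk pl Xlk.
    exact: ev_sub evk evl lk.
  + by move=> h; rewrite ifF // /wins; clear -h lk Xlk; lia.
  + by move=> h; rewrite ifT // /wins; clear -h lk Xlk; lia.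
Qed.

(** Sets of positions are predicates rather than intervals, because the two short windows together
    may leave a gap. *)
Definition finds (u : bool) (e : expr) (p : pred nat) : Prop :=
  exists2 m, ev e m & is_best (X u) p m.

Lemma finds_better u e e' p p' : (forall k, p k || p' k -> k < n) ->
  finds u e p -> finds u e' p' ->
  finds u (BetterE u e e') (fun k => p k || p' k).
Proof.
move=> pn [k ek bk] [l el bl]; have [pk _] := bk; have [pl _] := bl.
eexists; last exact: is_best_merge bk bl.
by apply: ev_better => //; apply: pn; rewrite ?pk ?pl ?orbT.
Qed.

Lemma finds_if u c (t : bool) e e' p p' : ev c t ->
  (t -> finds u e p) -> (~~ t -> finds u e' p') ->
  finds u (IfE c e e') (if t then p else p').
Proof.
case: t => ct h h'; [have [m em bm] := h isT|have [m em bm] := h' isT];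
  by exists m => //; apply: ev_ite ct _ _.
Qed.

Lemma finds_eq u e p p' : p =1 p' -> finds u e p -> finds u e p'.
Proof. by move=> pp [m em bm]; exists m => //; apply: is_best_eq bm. Qed.

Lemma finds_block u eq ea ec q a c : q < Q -> a <= c -> c < s ->
  q * s + c < n -> ev eq q -> ev ea a -> ev ec c ->
  finds u (BlockE u eq ea ec) (fun k => q * s + a <= k <= q * s + c).
Proof.
move=> qQ ac cs qn evq eva evc; have evk := ev_key qQ evq.
have as_ : a < s by apply: leq_ltn_trans cs.
set key_ := key b (block_code q) in evk.
have idx : (key_ * s + a) * s + c < NT * s * s.
  apply: (@leq_trans ((key_ * s + a).+1 * s));
    first by rewrite mulSn addnC ltn_add2r.
  by rewrite leq_mul2r key_idx ?orbT.
have e9 : nth [::] arrays (stack_index u 9) = argmin_table u.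
  by rewrite stack_arrayE.
have i9 : stack_index u 9 < 26 by case: (u).
have idxw : (key_ * s + a) * s + c < 2 ^ w.
  by apply: ltn_trans (size_lt (stack_index u 9)); rewrite e9 size_mkseq.
set best := best_from (item_pops (block q) u) a (c - a).
have bP : is_best (item_pops (block q) u) (fun k => a <= k <= c) best.
  by apply: is_best_eq (best_fromP _ _ _) => k /=; rewrite subnKC.
have [/andP[am mc] _] := bP.
have bs : best < s by apply: leq_ltn_trans cs.
have qbn : q * s + best < n.
  by apply: leq_ltn_trans qn; rewrite leq_add2l.
have z1 : ((key_ * s + a) * s + c) %/ s = key_ * s + a.
  by rewrite divnMDl // divn_small // addn0.
have z2 : (key_ * s + a) %/ s = key_ by rewrite divnMDl // divn_small // addn0.
have z3 : ((key_ * s + a) * s + c) %% s = c by rewrite modnMDl modn_small.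
have qsw : q * s < 2 ^ w.
  by apply: leq_ltn_trans (ltn_trans qbn n_lt); rewrite leq_addr.
exists (q * s + best).
  apply: ev_add; last exact: ltn_trans qbn n_lt.
    by apply: ev_mul.
  have -> : best = (fun z => let a := z %/ s %% s in
    best_from (item_pops (decode s C b v (z %/ s %/ s)) u) a (z %% s - a))
      ((key_ * s + a) * s + c).
    by rewrite /= z1 z2 modnMDl z3 modn_small // decode_block.
  apply: (ev_word e9 i9 idx).
    rewrite /= z1 z2 modnMDl z3 modn_small // decode_block -/best.
    by apply: leq_ltn_trans (ltn_trans qbn n_lt); rewrite leq_addl.
  have h1 : (key_ * s + a) * s < 2 ^ w.
    by apply: leq_ltn_trans idxw; rewrite leq_addr.
  have h2 : key_ * s + a < 2 ^ w.
    by apply: leq_ltn_trans h1; rewrite leq_pmulr.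
  apply: ev_add => //; apply: ev_mul => //; apply: ev_add => //.
  by apply: ev_mul => //; apply: leq_ltn_trans h2; rewrite leq_addr.
split; first by rewrite !leq_add2l am mc.
move=> k /andP[ak kc]; have qk : q * s <= k by apply: leq_trans ak;
  rewrite leq_addr.
(* Positions of one block are at most [s <= C] apart, so the clipped counts, all that the code
   records, compare them correctly. *)
rewrite /X -(@wins_clip U y C) -/XC.
- have shift t : a <= t <= c -> XC u (q * s + t) =
      XC u (q * s) + item_pops (block q) u t.
    by move=> /andP[_ tc]; apply: item_popsE; apply: leq_trans tc (ltnW cs).
  have [_] := is_best_shift shift bP; apply.
  by rewrite qk /= leq_subRL // leq_subLR ak.
- exact: leq_add qk (leq_trans (ltnW bs) s_C).
- apply: leq_trans kc _; rewrite -addnA leq_add2l.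
  by apply: leq_trans (leq_trans (ltnW cs) s_C) (leq_addl _ _).
Qed.

Lemma finds_short u el eq l q : l <= lam -> (q + 2 ^ l) * s <= n ->
  ev el l -> ev eq q ->
  finds u (ShortE u el eq) (fun k => q <= k %/ s < q + 2 ^ l).
Proof.
move=> ll qn evl evq.
have l0 : 0 < 2 ^ l * s by rewrite muln_gt0 expn_gt0.
set best := best_from (X u) (q * s) (2 ^ l * s).-1.
have bP : is_best (X u) (fun k => q <= k %/ s < q + 2 ^ l) best.
  apply: is_best_eq (best_fromP _ _ _) => k; rewrite leq_divRL // ltn_divLR //.
  by rewrite -[k <= _]ltnS -addnS prednK // mulnDl.
have [/andP[qb bq] _] := bP.
have bn : best < n by move: bq; rewrite ltn_divLR // => /leq_trans; apply.
move: qb; rewrite leq_divRL // => qb.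
have qQ : q < Q.
  by apply: leq_ltn_trans (block_lt bn); rewrite leq_divRL.
have e5 : nth [::] arrays (stack_index u 5) = short_table u.
  by rewrite stack_arrayE.
have idx : l * Q + q < lam.+1 * Q.
  apply: (@leq_trans (l.+1 * Q)); first by rewrite mulSn addnC ltn_add2r.
  by rewrite leq_mul2r ltnS ll orbT.
have Q0 : 0 < Q by apply: leq_ltn_trans qQ.
have zE : (let q' := (l * Q + q) %% Q in
    best_from (X u) (q' * s) (2 ^ ((l * Q + q) %/ Q) * s).-1 - q' * s) =
    best - q * s.
  by rewrite /= modnMDl modn_small // divnMDl // divn_small // addn0.
exists best => //; rewrite -(subnKC qb); apply: ev_add.
- apply: ev_mul => //.
  by apply: leq_ltn_trans qb (ltn_trans bn n_lt).
- rewrite -zE.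
  apply: (@ev_pack (fun z => let q := z %% Q in
    best_from (X u) (q * s) (2 ^ (z %/ Q) * s).-1 - q * s) (lam.+1 * Q)) => //.
  + by case: (u).
  + rewrite /= in zE; rewrite /= zE; apply: leq_ltn_trans Gs_f.
    apply: (@leq_trans (G * s)); last by rewrite leq_pmulr.
    rewrite leq_subLR; apply: ltnW; move: bq;
      rewrite ltn_divLR // => /leq_trans; apply.
    by rewrite mulnDl leq_add2l leq_mul2r leq_exp2l // ll orbT.
  + apply: ev_add => //; last exact: ltn_trans idx lamQ.
    apply: ev_mul => //; first exact: (@ev_param 5 isT).
    by apply: leq_ltn_trans (ltn_trans idx lamQ); rewrite leq_addr.
- by rewrite subnKC // (ltn_trans bn n_lt).
Qed.

Lemma finds_long u el eq l q : l < w -> (q + 2 ^ l) * G * s <= n ->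
  ev el l -> ev eq q ->
  finds u (LongE u el eq) (fun k => q <= k %/ s %/ G < q + 2 ^ l).
Proof.
move=> ll qn evl evq.
have l0 : 0 < 2 ^ l * G * s by rewrite !muln_gt0 expn_gt0 G_gt0 s_gt0.
set best := best_from (X u) (q * G * s) (2 ^ l * G * s).-1.
have bP : is_best (X u) (fun k => q <= k %/ s %/ G < q + 2 ^ l) best.
  apply: is_best_eq (best_fromP _ _ _) => k.
  rewrite !leq_divRL // !ltn_divLR //.
  by rewrite -[k <= _]ltnS -addnS prednK // !mulnDl.
have [/andP[qb bq] _] := bP.
have bn : best < n by move: bq; rewrite !ltn_divLR // => /leq_trans; apply.
have qN : q < N.
  by apply: leq_ltn_trans qb (super_lt (block_lt bn)).
have e6 : nth [::] arrays (stack_index u 6) = long_table u.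
  by rewrite stack_arrayE.
have idx : l * N + q < w * N.
  apply: (@leq_trans (l.+1 * N)); first by rewrite mulSn addnC ltn_add2r.
  by rewrite leq_mul2r ll orbT.
have idxw : l * N + q < 2 ^ w.
  by apply: ltn_trans (size_lt (stack_index u 6)); rewrite e6 size_mkseq.
have N0 : 0 < N by apply: leq_ltn_trans qN.
have zE : best_from (X u) ((l * N + q) %% N * G * s)
    (2 ^ ((l * N + q) %/ N) * G * s).-1 = best.
  by rewrite /= modnMDl modn_small // divnMDl // divn_small // addn0.
exists best => //; rewrite -zE.
apply: (ev_word (g := fun z => best_from (X u) (z %% N * G * s)
    (2 ^ (z %/ N) * G * s).-1) e6) => //.
- by case: (u).
- by rewrite zE (ltn_trans bn n_lt).
- apply: ev_add => //; apply: ev_mul => //; first exact: (@ev_param 6 isT).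
  by apply: leq_ltn_trans idxw; rewrite leq_addr.
Qed.

Lemma ev_log e x : x <= G + N -> ev e x -> ev (LogE e) (trunc_log 2 x).
Proof.
move=> xle ex; apply: (@ev_word (trunc_log 2) (G + N).+1) => //.
have xw : x < 2 ^ w.
  have e1 : nth [::] arrays 1 = mkseq (trunc_log 2) (G + N).+1 by [].
  by apply: leq_ltn_trans xle _; have := size_lt 1;
    rewrite e1 size_mkseq => /ltnW.
apply: leq_ltn_trans xw; case: (x) => // x'.
by rewrite ltnW // (leq_trans (ltn_expl _ (isT : 1 < 2))) // trunc_logP.
Qed.

Lemma trunc_log_cover a c x : a < c ->
  (a <= x < a + 2 ^ trunc_log 2 (c - a)) ||
  (c - 2 ^ trunc_log 2 (c - a) <= x < c - 2 ^ trunc_log 2 (c - a) +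
     2 ^ trunc_log 2 (c - a)) = (a <= x < c).
Proof.
move=> ac; have := trunc_log_ltn (c - a) (isT : 1 < 2); rewrite expnS.
have := @trunc_logP 2 (c - a) isT; rewrite subn_gt0 => /(_ ac).
set p := 2 ^ _; move: p ac; clear => p; lia.
Qed.

(* The query range is covered by its first and last block, two overlapping     *)
(* short windows of blocks in between, and, when these do not suffice, two     *)
(* overlapping windows of superblocks.                                         *)
Lemma finds_query u ei ej i0 j0 : i0 <= j0 -> j0 < n ->
  ev ei i0 -> ev ej j0 -> finds u (QueryE u ei ej) (fun k => i0 <= k <= j0).
Proof.
move=> ij jn evi evj.
have evqi : ev (ei %/ sE)%expr (i0 %/ s) by apply: ev_div.
have evqj : ev (ej %/ sE)%expr (j0 %/ s) by apply: ev_div.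
have evti : ev (ei %% sE)%expr (i0 %% s) by apply: ev_mod.
have evtj : ev (ej %% sE)%expr (j0 %% s) by apply: ev_mod.
have qjQ : j0 %/ s < Q by apply: block_lt.
have qij : i0 %/ s <= j0 %/ s by apply: leq_div2r.
have qjn : j0 %/ s * s <= n by apply: leq_trans (leq_trunc_div _ _) (ltnW jn).
have qjw : j0 %/ s < 2 ^ w by apply: ltn_trans Q_lt.
have lo k : i0 <= k -> i0 %/ s <= k %/ s by apply: leq_div2r.
have hi k : k <= j0 -> k %/ s <= j0 %/ s by apply: leq_div2r.
have lo' k : i0 %/ s < k %/ s -> i0 <= k.
  by apply: contraTT; rewrite -!ltnNge ltnS => /ltnW; apply: leq_div2r.
have hi' k : k %/ s < j0 %/ s -> k <= j0.
  by apply: contraTT; rewrite -!ltnNge ltnS => /ltnW; apply: leq_div2r.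
have iE : i0 = i0 %/ s * s + i0 %% s by apply: divn_eq.
have jE : j0 = j0 %/ s * s + j0 %% s by apply: divn_eq.
have it_s : i0 %% s < s by rewrite ltn_mod.
have jt_s : j0 %% s < s by rewrite ltn_mod.
set qi := i0 %/ s in evqi qij lo lo' iE *.
set qj := j0 %/ s in evqj qij hi hi' qjQ qjn qjw jE *.
rewrite /QueryE /=.
set c0 := if qi < qj then s - 1 else j0 %% s.
set first := BlockE _ _ _ _.
have evlt : ev (ei %/ sE < ej %/ sE)%expr (qi < qj) by apply: ev_lt.
have ev1 : ev (Lit 1) 1 by apply: ev_small.
have first_ok : finds u first (fun k => (i0 <= k <= j0) && (k %/ s == qi)).
  have evc0 : ev (IfE (ei %/ sE < ej %/ sE)%expr (sE - Lit 1)%expr (ej %%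
    sE)%expr) c0.
    rewrite /c0; apply: ev_ite evlt _ _ => [-> |/negPf ->] //.
    exact: ev_sub.
  have c0s : c0 < s by rewrite /c0; case: ifP => // _; rewrite subn1 prednK.
  have qiqj : qi < qj \/ qi = qj.
    by move: qij; rewrite leq_eqVlt => /orP[/eqP ->|]; [right|left].
  have ac : i0 %% s <= c0.
    rewrite /c0; case: qiqj => [h|h].
      by rewrite h subn1 -ltnS prednK.
    by rewrite h ltnn; move: ij; rewrite {1}iE {1}jE h leq_add2l.
  have c0n : qi * s + c0 < n.
    rewrite /c0; case: qiqj => [h|h]; last by rewrite h ltnn -jE.
    rewrite h; apply: leq_trans qjn; rewrite subn1 -addnS prednK //.
    by rewrite -mulSnr leq_mul2r h orbT.
  have qiQ : qi < Q by apply: leq_ltn_trans qjQ.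
  apply: finds_eq (finds_block u qiQ ac c0s c0n evqi evti evc0) => k.
  rewrite -iE /c0; have := lo k; have := hi k; have := hi' k.
  case: qiqj => [h|h]; last first.
    rewrite h ltnn -jE; clear -h.
    case: (i0 <= k) => //= _ h2 /(_ isT); case: (k <= j0) h2 => //= /(_ isT);
      lia.
  rewrite h -[k <= qi * s + _]ltnS -addnS subn1 prednK // -mulSnr -ltn_divLR //.
  by clear -h; case: (i0 <= k) => //= h1 h2 h3; move: (h3 isT);
    case: (k <= j0) h1 h2; lia.
set last := IfE _ _ first.
have last_ok : finds u last (if qi < qj
    then fun k => (i0 <= k <= j0) && (k %/ s == qj)
    else fun k => (i0 <= k <= j0) && (k %/ s == qi)).
  apply: finds_if => // h.
  have tn : qj * s + j0 %% s < n by rewrite -jE.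
  apply: finds_eq (finds_block u qjQ (leq0n _) jt_s tn evqj (@ev_small 0 isT)
    evtj) => k.
  rewrite addn0 -jE -leq_divRL //; have := lo k; have := hi k; have := lo' k.
  by clear -h; case: (k <= j0); rewrite ?andbT ?andbF //= => h1 h2;
    move: (h2 isT);
    case: (i0 <= k) h1; lia.
have evqi1 : ev (ei %/ sE + Lit 1)%expr (qi + 1).
  by apply: ev_add => //; apply: leq_ltn_trans Q_lt; rewrite addn1;
    apply: leq_ltn_trans qjQ.
have evG : ev GE G by apply: (@ev_param 2 isT).
have log_lt x : 0 < x -> x <= qj -> trunc_log 2 x < w.
  move=> x0 xq; rewrite -(@ltn_exp2l 2) //; apply: leq_ltn_trans qjw.
  by apply: leq_trans xq; apply: trunc_logP.
set short := IfE (_ + _ < _)%expr _ first.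
pose L := qj - qi - 1.
pose l := trunc_log 2 (if L < G then L else G).
(* With at least [G] blocks strictly between the outer ones, the short windows are the first and the
   last [G] of these; otherwise they cover all of them. *)
have short_ok : finds u short (if qi + 1 < qj
    then fun k => (qi + 1 <= k %/ s < qj) &&
      [|| L < G, k %/ s < qi + 1 + G | qj - G <= k %/ s]
    else fun k => (i0 <= k <= j0) && (k %/ s == qi)).
  apply: finds_if => // [|h]; first exact: ev_lt.
  have evL : ev (ej %/ sE - ei %/ sE - Lit 1)%expr L.
    apply: ev_sub => //; first exact: ev_sub.
    by clear -h; lia.
  have evmin : ev (IfE (ej %/ sE - ei %/ sE - Lit 1 < GE)%expr
      (ej %/ sE - ei %/ sE - Lit 1)%expr GE) (if L < G then L else G).
    apply: ev_ite (ev_lt w_gt0 evL evG) _ _ => [->|/negPf ->] //.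
  have min_gt0 : 0 < (if L < G then L else G).
    by case: ifP => _ //; rewrite /L; clear -h; lia.
  have p2l : 2 ^ l <= (if L < G then L else G) by apply: trunc_logP.
  have p2L : 2 ^ l <= L by apply: leq_trans p2l _; case: ltnP.
  have p2G : 2 ^ l <= G by apply: leq_trans p2l _; case: ltnP => // /ltnW.
  have evl : ev (LogE (IfE (ej %/ sE - ei %/ sE - Lit 1 < GE)%expr
      (ej %/ sE - ei %/ sE - Lit 1)%expr GE)) l.
    apply: ev_log => //; apply: (@leq_trans G); last exact: leq_addr.
    by case: ltnP => // /ltnW.
  have lw : l < w.
    rewrite -(@ltn_exp2l 2) //; apply: leq_ltn_trans qjw.
    by apply: leq_trans p2L _; rewrite /L -subnDA leq_subr.
  have l_lam : l <= lam by rewrite -(@leq_exp2l 2).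
  have p2q : 2 ^ l <= qj by apply: leq_trans p2L _; rewrite /L -subnDA leq_subr.
  have p2q' : qi + 1 + 2 ^ l <= qj.
    by move: p2L; rewrite /L; clear -h; lia.
  apply: (@finds_eq _ _ (fun k => (qi + 1 <= k %/ s < qi + 1 + 2 ^ l) ||
      (qj - 2 ^ l <= k %/ s < qj - 2 ^ l + 2 ^ l))) => [k|].
    have LE : L = qj - (qi + 1) by rewrite /L subnDA.
    rewrite /l; case: (ltnP L G) => [_|GL];
      first by rewrite /= LE trunc_log_cover ?andbT.
    rewrite trunc_expnK // -/G; move: (k %/ s) GL h; rewrite LE.
    by clearbody G qi qj; clear => x; lia.
  apply: finds_better.
  - move=> k hk; apply: leq_ltn_trans jn; apply: hi'.
    move: hk p2q p2q'; clear; lia.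
  - apply: finds_short => //; apply: leq_trans qjn.
    by rewrite leq_mul2r p2q' orbT.
  - apply: finds_short => //; first by rewrite subnK.
    by apply: ev_sub => //; apply: ev_pow.
set long := IfE (_ < _)%expr _ first.
pose pi := qi %/ G + 1; pose pj := qj %/ G.
pose h := trunc_log 2 (pj - pi).
have long_ok : finds u long (if pi < pj
    then fun k => pi <= k %/ s %/ G < pj
    else fun k => (i0 <= k <= j0) && (k %/ s == qi)).
  have evpj : ev (ej %/ sE %/ GE)%expr pj by apply: ev_super.
  have evpi : ev (ei %/ sE %/ GE + Lit 1)%expr pi.
    apply: ev_add => //; first exact: ev_super.
    by apply: leq_ltn_trans N_lt;
      rewrite leq_add2r leq_div2r // (leq_trans qij) // ltnW.
  apply: finds_if => // [|hp]; first exact: ev_lt.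
  have d0 : 0 < pj - pi by rewrite subn_gt0.
  have pjq : pj <= qj by apply: leq_div.
  have p2d : 2 ^ h <= pj - pi by apply: trunc_logP.
  have evh : ev (LogE (ej %/ sE %/ GE - (ei %/ sE %/ GE + Lit 1))%expr) h.
    apply: ev_log; last by apply: ev_sub => //; apply: ltnW.
    apply: leq_trans (leq_subr _ _) _; apply: leq_trans (leq_addl G N).
    by apply: ltnW; apply: super_lt.
  have hw : h < w.
    by apply: log_lt => //; apply: leq_trans (leq_subr _ _) pjq.
  have p2p : pi + 2 ^ h <= pj by move: p2d hp; clear; lia.
  have p2p' : 2 ^ h <= pj by apply: leq_trans p2d (leq_subr _ _).
  have pjn : pj * G * s <= n.
    by apply: leq_trans qjn; rewrite leq_mul2r leq_trunc_div orbT.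
  apply: finds_eq (fun k => trunc_log_cover _ hp) _.
  apply: finds_better.
  - move=> k hk; apply: leq_ltn_trans jn; apply: hi'.
    have : k %/ s %/ G < pj.
      case/orP: hk => /andP[_ kh]; apply: leq_trans kh _ => //.
      by rewrite subnK.
    by apply: contraTT; rewrite -!leqNgt; apply: leq_div2r.
  - apply: finds_long => //; apply: leq_trans pjn.
    by rewrite !leq_mul2r p2p !orbT.
  - apply: finds_long => //; first by rewrite subnK.
    by apply: ev_sub => //; apply: ev_pow.
have to_i k : pi <= k %/ s %/ G -> qi < k %/ s.
  rewrite /pi addn1; apply: contraTT; rewrite -!leqNgt; apply: leq_div2r.
have to_j k : k %/ s %/ G < pj -> k %/ s < qj.
  by apply: contraTT; rewrite -!leqNgt; apply: leq_div2r.
set P0 := fun k => (i0 <= k <= j0) && (k %/ s == qi) in short_ok long_ok *.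
have last_in k : (if qi < qj then fun k => (i0 <= k <= j0) && (k %/ s == qj)
    else P0) k -> i0 <= k <= j0.
  by case: ifP => _ /andP[].
have short_in k : (if qi + 1 < qj
    then fun k => (qi + 1 <= k %/ s < qj) &&
      [|| L < G, k %/ s < qi + 1 + G | qj - G <= k %/ s]
    else P0) k -> i0 <= k <= j0.
  case: ifP => _ /andP[] //; rewrite addn1 => /andP[/lo' -> /hi' ->] //.
have long_in k : (if pi < pj then fun k => pi <= k %/ s %/ G < pj else P0) k ->
    i0 <= k <= j0.
  by case: ifP => _ /andP[] // /to_i /lo' -> /to_j /hi' ->.
have in_n k : i0 <= k <= j0 -> k < n by case/andP => _ /leq_ltn_trans; apply.
apply: (finds_eq _ (finds_better _ (finds_better _ first_ok last_ok)
  (finds_better _ short_ok long_ok))) => k.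
- apply/idP/idP => [/orP[/orP[/andP[] //|/last_in]|/orP[/short_in|/long_in]]
  //|].
  move=> kij; have /andP[/lo qk /hi kq] := kij.
  have [kqi|kqi] := eqVneq (k %/ s) qi; first by rewrite /P0 kij ?kqi ?eqxx.
  have {kqi}qk : qi < k %/ s by rewrite ltn_neqAle eq_sym kqi.
  have qq : qi < qj by apply: leq_trans kq.
  have [kqj|kqj] := eqVneq (k %/ s) qj; first by rewrite qq kij ?kqj ?eqxx orbT.
  have {kqj}kq : k %/ s < qj by rewrite ltn_neqAle kqj.
  have -> : qi + 1 < qj by rewrite addn1; apply: leq_ltn_trans kq.
  rewrite addn1 qk kq /=; case: (ltnP L G) => [_|GL] /=; first by rewrite !orbT.
  case: (ltnP (k %/ s) (qi.+1 + G)) => [_|h1] /=; first by rewrite !orbT.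
  case: (leqP (qj - G) (k %/ s)) => [_|h2] /=; first by rewrite !orbT.
  (* A block missed by both short windows is more than [G] blocks away from each outer block, so its
     superblock lies strictly between theirs. *)
  have GG : G %/ G = 1 by rewrite divnn G_gt0.
  have hpi : pi <= k %/ s %/ G.
    rewrite /pi -GG -divnDr ?dvdnn // leq_div2r //.
    by apply: leq_trans h1; rewrite leq_add2r.
  have hpj : k %/ s %/ G < pj.
    rewrite -addn1 -GG -divnDr ?dvdnn // leq_div2r //.
    by move: h2 GL; rewrite /L; clearbody G qi qj; move: (k %/ s) => x; clear;
      lia.
  by rewrite (leq_ltn_trans hpi hpj) hpi hpj !orbT.
- by case/orP => [/orP[/andP[/in_n]|/last_in/in_n]
  //|/orP[/short_in|/long_in]/in_n].
- by case/orP => [/andP[/in_n]|/last_in/in_n].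
- by case/orP => [/short_in|/long_in] /in_n.
Qed.

End Structure.

(** * Choice of the parameters *)

Definition lgw (w : nat) : nat := up_log 2 w.
Lemma exp_lgw_le w : 1 < w -> 2 ^ lgw w <= 2 * w.
Proof.
move=> w1; have /andP[h _] := up_log_bounds (isT : 1 < 2) w1.
have v0 : 0 < lgw w by rewrite up_log_gt0.
by rewrite -(prednK v0) expnS leq_mul2l ltnW.
Qed.

Definition code_len (K w : nat) : nat := w %/ K.
(** A step in the fixed-width code takes [2 * lgw w + 2] bits: one for the stack and [2 * lgw w + 1]
    for a number up to [2 ^ (2 * lgw w)]. The predecessor leaves room for the leading bit. *)
Definition block_len (K w : nat) : nat := (code_len K w).-1 %/ (2 * lgw w).+2.
(** The terms are the directory per block, the lists of [excess] for both stacks, and the lookup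
    tables with lower-order parts. In the first, 394 is 8 times 48 for packed arrays, 9 for data per
    superblock and 1 for leading bits. *)
Definition redundancy (K w n : nat) : nat :=
  394 * (lgw w) ^ 2 * (n %/ block_len K w + 1) + 2 * (n %/ w) +
  71 * w ^ 4 * 2 ^ code_len K w.

Section Encoding.
Variables (K w n : nat) (U : nat -> bool) (y : nat -> nat).
Let v := lgw w.
Let b := code_len K w.
Let s := block_len K w.

(** The clipping bound is at least [w ^ 2], so each list of [excess] costs about [n / w] bits.
    Superblocks of at least [w ^ 3] blocks bring their tables down to [O(1)] bits per block, up to
    lower-order terms. Fields of [6 * v] bits hold every difference inside a superblock. *)
Definition encoding : seq bool :=
  data w n s b (2 * v).+1 (3 * v) (6 * v) (w %/ (6 * v)) (2 ^ (2 * v)) U y.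

Hypotheses (n_lt : n < 2 ^ w) (w_ge : 8 <= w) (K_gt1 : 1 < K) (s_gt0 : 0 < s)
  (f_lt : 6 * v < w) (R_le : redundancy K w n <= n)
  (y_sum : forall k, \sum_(l < k) y l <= n)
  (X_le : forall u k, k < n -> pops U y u k <= k).

Let w_le : w <= 2 ^ v. Proof. exact: up_logP. Qed.

Let w_gt : 2 ^ v <= 2 * w.
Proof. by apply: exp_lgw_le; clear -w_ge; lia. Qed.

Let v_gt0 : 0 < v. Proof. by rewrite up_log_gt0 //; clear -w_ge; lia. Qed.

Let b_lt : b < w.
Proof. by apply: ltn_Pdiv => //; clear -w_ge; lia. Qed.

Let s_b : s * (2 * v).+2 < b.
Proof.
have : s * (2 * v).+2 <= b.-1 by apply: leq_trunc_div.
by move: s_gt0; clearbody b s; clear; nia.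
Qed.

Let s_le : 2 * s <= w.
Proof. by move: s_b b_lt; clearbody b s v; clear; nia. Qed.

Lemma encoding_words :
  w * size (layout (arrays w n s b (2 * v).+1 (3 * v) (6 * v) (w %/ (6 * v))
    (2 ^ (2 * v)) U y)) + (2 * s + (n %/ s + 1)) <= redundancy K w n.
Proof.
set Q := n %/ s + 1; have w0 : 0 < w by clear -w_ge; lia.
have kap0 : 0 < w %/ (6 * v).
  by rewrite divn_gt0 ?(ltnW f_lt) // muln_gt0.
have := @size_layout_arrays_le w n s b (2 * v).+1 (3 * v) (6 * v)
  (w %/ (6 * v)) (2 ^ (2 * v)) U y s_gt0 kap0 w0.
rewrite -/Q; set G := 2 ^ (3 * v); set A := _ %/ (w %/ _).
set D := n %/ 2 ^ (2 * v); set W := size _; set q := Q %/ G.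
have GE : G = 2 ^ v * 2 ^ v * 2 ^ v by rewrite -!expnD; congr (2 ^ _); clear;
  lia.
have hG : G <= 8 * w ^ 3.
  rewrite GE; apply: leq_trans (leq_mul (leq_mul w_gt w_gt) w_gt) _.
  by rewrite !expnS expn0; clear; lia.
have hq : w * w * q <= Q.
  apply: leq_trans (leq_trunc_div Q G); rewrite mulnC leq_mul2l GE.
  apply/orP; right; apply: (@leq_trans (2 ^ v * 2 ^ v)); first exact: leq_mul.
  by rewrite leq_pmulr // expn_gt0.
have hA : w * A <= 48 * v ^ 2 * Q.
  have h1 : w <= 2 * (6 * v * (w %/ (6 * v))).
    have := divn_eq w (6 * v);
      have : w %% (6 * v) < 6 * v by rewrite ltn_mod muln_gt0.
    move: kap0; clear; move: (w %/ _) (w %% _) => k r; nia.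
  have h2 : A * (w %/ (6 * v)) <= (3 * v).+1 * Q by apply: leq_trunc_div.
  have h3 : (3 * v).+1 <= 4 * v by move: v_gt0; clear; lia.
  apply: (leq_trans (leq_mul h1 (leqnn A))).
  have -> : 2 * (6 * v * (w %/ (6 * v))) * A = 12 * v * (A * (w %/ (6 * v))).
    by clear; move: (w %/ _) => k; lia.
  apply: (leq_trans (leq_mul (leqnn _) h2)).
  rewrite mulnA leq_mul2r; apply/orP; right.
  by move: h3; clear; nia.
have hD : w * D <= n %/ w.
  rewrite leq_divRL // mulnAC; apply: leq_trans (leq_trunc_div n (2 ^ (2 * v))).
  rewrite mulnC leq_mul2l; apply/orP; right.
  by rewrite mul2n -addnn expnD leq_mul.
have hT : w * ((b.+1 * 2 ^ b) * s * s) <= w ^ 4 * 2 ^ b.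
  have -> : w ^ 4 * 2 ^ b = w * (w * 2 ^ b * w * w) by rewrite !expnS expn0;
    clear; lia.
  have sw : s <= w by apply: leq_trans s_le; rewrite leq_pmull.
  by rewrite leq_mul2l; apply/orP; right; do 3 apply: leq_mul => //.
have hw4 : w ^ 4 <= w ^ 4 * 2 ^ b by rewrite leq_pmulr // expn_gt0.
move=> hW; apply: (leq_trans (leq_add (leq_mul (leqnn w) hW) (leqnn _))).
rewrite /redundancy -/b -/s -/Q -/v.
have hN : w * (9 * (w * (q + 1))) <= 9 * Q + 9 * w ^ 2.
  by move: hq; clear; rewrite expnS expn1; lia.
have hG4 : w * G <= 8 * w ^ 4.
  by rewrite (expnS w 3) mulnCA leq_mul2l hG orbT.
have hw1 : w <= w ^ 4 by rewrite -{1}[w]expn1 leq_pexp2l.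
have hw2 : w ^ 2 <= w ^ 4 by rewrite leq_pexp2l.
have hv : Q <= v ^ 2 * Q by rewrite leq_pmull // expn_gt0 v_gt0.
move: hN hG4 hA hD hT hw4 hw1 hw2 hv s_le.
rewrite -(mulnA 71).
move: (w ^ 4 * 2 ^ b) (w ^ 4) (w ^ 2) (b.+1 * 2 ^ b * s * s) (v ^ 2).
clearbody Q G A D q; clear => X Y Z T V; move: (n %/ w) => nw; lia.
Qed.

Let s_lt : 2 * s < w.
Proof. by move: s_b b_lt v_gt0; clearbody b s v; clear; nia. Qed.

Lemma size_encoding : size encoding <= 3 * n + redundancy K w n.
Proof.
rewrite /encoding /data size_cat size_bits_of_words mulnC.
apply: leq_trans (leq_add (leqnn _) (size_stream_le _ _ s_b s_gt0 y_sum)) _.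
by rewrite addnCA leq_add2l encoding_words.
Qed.

Let v2_ge u m : u <= m -> 2 ^ u <= 2 ^ m.
Proof. by move=> um; rewrite leq_exp2l. Qed.

Lemma ev_encoding u i j : 0 < i -> i <= j -> j <= n ->
  exists2 m, is_best (pops U y u) (fun k => i.-1 <= k <= j.-1) m &
  eval_expr w (memory_of_bits w encoding) i j
    (QueryE u (Arg false - Lit 1) (Arg true - Lit 1) + Lit 1)%expr = m.+1.
Proof.
move=> i0 ij jn.
have iw : i < 2 ^ w by apply: leq_ltn_trans n_lt; apply: leq_trans jn.
have jw : j < 2 ^ w by apply: leq_ltn_trans n_lt.
have s_v : s < 2 ^ v by apply: leq_trans w_le; move: s_lt; clear; lia.
have sC : s <= 2 ^ (2 * v).
  by apply: ltnW; apply: leq_trans s_v _; apply: v2_ge; rewrite leq_pmull.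
have Cv : 2 ^ (2 * v) < 2 ^ (2 * v).+1 by rewrite ltn_exp2l.
have p0 : 0 < 2 ^ v by rewrite expn_gt0.
have Gs_f : 2 ^ (3 * v) * s * (2 ^ (2 * v)).+1 < 2 ^ (6 * v).
  have -> : 2 ^ (6 * v) = 2 ^ (3 * v) * (2 ^ v * 2 ^ (2 * v)).
    by rewrite -!expnD; congr (2 ^ _); clear; lia.
  rewrite -mulnA ltn_pmul2l ?expn_gt0 //.
  have C0 : 0 < 2 ^ (2 * v) by rewrite expn_gt0.
  have h : 2 * s < 2 ^ v by apply: leq_trans w_le.
  by move: C0 h s_gt0; move: (2 ^ (2 * v)) (2 ^ v); clearbody s; clear; nia.
have Gb_f : 2 ^ (3 * v) * b < 2 ^ (6 * v).
  have -> : 2 ^ (6 * v) = 2 ^ (3 * v) * 2 ^ (3 * v).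
    by rewrite -!expnD; congr (2 ^ _); clear; lia.
  rewrite ltn_pmul2l ?expn_gt0 //; apply: leq_trans b_lt _.
  by apply: leq_trans w_le _; apply: v2_ge; rewrite leq_pmull.
have kap0 : 0 < w %/ (6 * v) by rewrite divn_gt0 ?(ltnW f_lt) // muln_gt0.
have kap_f : w %/ (6 * v) * (6 * v) <= w by apply: leq_trunc_div.
have lamQ : (3 * v).+1 * (n %/ s + 1) < 2 ^ w.
  apply: leq_ltn_trans n_lt; apply: leq_trans R_le.
  rewrite /redundancy -addnA; apply: leq_trans (leq_addr _ _).
  rewrite leq_mul2r; apply/orP; right; rewrite -/v.
  by move: v_gt0; clearbody v; clear; rewrite expnS expn1; nia.
set lay := layout (arrays w n s b (2 * v).+1 (3 * v) (6 * v) (w %/ (6 * v))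
    (2 ^ (2 * v)) U y).
set st := stream n s b (2 * v).+1 (2 ^ (2 * v)) U y.
(* All data have at most [4 n] bits and [w >= 8], so they fill at most about [n / 2] words. *)
have mem_lt : size lay + (size st %/ w).+1 < 2 ^ w.
  have := size_encoding; rewrite /encoding /data size_cat size_bits_of_words.
  rewrite -/lay -/st; have := leq_trunc_div (size st) w; move: R_le n_lt w_ge.
  have : 2 ^ 2 <= 2 ^ w by apply: v2_ge; move: w_ge; clear; lia.
  clear; move: (redundancy _ _ _) (2 ^ w) (size st %/ w) (size st) (size lay).
  move=> R p q l m; nia.
have ei : ev w (memory_of_bits w encoding) i j (Arg false - Lit 1)%expr i.-1.
  have w0 : 0 < w by move: w_ge; clear; lia.
  rewrite -subn1; apply: ev_sub; [exact: (ev_arg _ iw jw false)| |by []].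
  by apply: ev_lit; apply: leq_ltn_trans iw.
have ej : ev w (memory_of_bits w encoding) i j (Arg true - Lit 1)%expr j.-1.
  rewrite -subn1; apply: ev_sub; first exact: (ev_arg _ iw jw true).
    by apply: ev_lit; apply: leq_ltn_trans iw.
  exact: leq_trans ij.
have ij1 : i.-1 <= j.-1 by rewrite -!subn1 leq_sub2r.
have jn1 : j.-1 < n by rewrite prednK // (leq_trans i0).
have [m em bm] := finds_query n_lt s_gt0 s_b b_lt kap0 kap_f f_lt sC Cv Gs_f
  Gb_f
  lamQ mem_lt y_sum X_le iw jw u ij1 jn1 ei ej.
exists m => //; have [/andP[_ mj] _] := bm.
have mn : m < n by apply: leq_ltn_trans jn1.
have [] : ev w (memory_of_bits w encoding) i j
   (QueryE u (Arg false - Lit 1) (Arg true - Lit 1) + Lit 1)%expr (m + 1).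
  apply: ev_add => //; last by rewrite addn1 (leq_ltn_trans mn).
  by apply: ev_lit; apply: leq_ltn_trans iw.
by rewrite addn1.
Qed.

End Encoding.

(** * Short words *)

(** A cursor that stops at [j]. Without sharing its size is exponential in [t], which is still
    constant since [t] is bounded in terms of the threshold on [w]. *)
Fixpoint PosE (t : nat) : expr :=
  if t is t'.+1 then
    IfE (PosE t' < Arg true)%expr (PosE t' + Lit 1)%expr (PosE t')
  else Arg false.

Fixpoint ScanE (u : bool) (t : nat) : expr :=
  if t is t'.+1 then
    let p := PosE t in
    let c := ScanE u t' in
    IfE (if u then Fetch c < Fetch p else Fetch p < Fetch c)%expr p c
  else Arg false.

(** Ranks compare like the entries themselves, ties included, and they fit into words. *)
Definition rank (lt : rel nat) (n k : nat) : nat :=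
  count (lt^~ k) (iota 0 n.+1).

Definition ranks (lt : rel nat) (n w : nat) : seq bool :=
  bits_of_words w (mkseq (rank lt n) (2 ^ w)).

Lemma size_ranks lt n w : size (ranks lt n w) = w * 2 ^ w.
Proof. by rewrite size_bits_of_words size_mkseq mulnC. Qed.

Section Ranks.
Variable lt : rel nat.
Hypotheses (lt_irr : irreflexive lt) (lt_trans : transitive lt)
  (lt_total : forall k l, k != l -> lt k l || lt l k).

Lemma rankE n k : k <= n ->
  (rank lt n k).+1 = count (predU (lt^~ k) (pred1 k)) (iota 0 n.+1).
Proof.
move=> kn; have := count_predUI (lt^~ k) (pred1 k) (iota 0 n.+1).
rewrite (count_uniq_mem _ (iota_uniq _ _)) mem_iota ltnS kn addn1 => <-.
rewrite [X in _ + X](_ : _ = 0) ?addn0 //.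
rewrite -[RHS](count_pred0 (iota 0 n.+1)); apply: eq_count => x /=.
by have [->|] := eqVneq x k; rewrite ?lt_irr ?andbF.
Qed.

Lemma rank_le n k : k <= n -> rank lt n k <= n.
Proof.
move=> kn; rewrite -ltnS rankE //.
by apply: leq_trans (count_size _ _) _; rewrite size_iota.
Qed.

Lemma rank_lt n k l : k <= n -> lt k l -> rank lt n k < rank lt n l.
Proof.
move=> kn kl; rewrite rankE //; apply: sub_count => x /= /orP[xk|/eqP -> //].
exact: lt_trans kl.
Qed.

Lemma rank_ltE n k l : k <= n -> l <= n -> k != l ->
  (rank lt n k < rank lt n l) = lt k l.
Proof.
move=> kn ln /lt_total /orP[h|h]; first by rewrite h rank_lt.
have /ltnW := rank_lt ln h; rewrite leqNgt => /negPf ->.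
by apply/esym/negP => /lt_trans/(_ h); rewrite lt_irr.
Qed.

Variables (w n i j : nat).
Hypotheses (n_lt : n < 2 ^ w) (i_gt0 : 0 < i) (ij : i <= j) (jn : j <= n).

Local Notation mem_ := (memory_of_bits w (ranks lt n w)).
Local Notation ev := (ev w mem_ i j).

Let i_lt : i < 2 ^ w. Proof. exact: leq_ltn_trans (leq_trans ij jn) n_lt. Qed.
Let j_lt : j < 2 ^ w. Proof. exact: leq_ltn_trans jn n_lt. Qed.
Let w_gt0 : 0 < w.
Proof. by case: w i_lt => //; rewrite expn0 ltnS leqn0; case: i i_gt0. Qed.
Let m_lt := memory_of_bits_lt w (ranks lt n w).

Lemma memory_rank k : k <= n -> mem_ k = rank lt n k.
Proof.
move=> kn; rewrite /ranks -[bits_of_words _ _]cats0 memory_of_words.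
  rewrite nth_mkseq ?(leq_ltn_trans kn) // modn_small //.
  by apply: leq_ltn_trans n_lt; apply: rank_le.
by rewrite size_mkseq (leq_ltn_trans kn).
Qed.

Lemma ev_pos t : ev (PosE t) (minn (i + t) j).
Proof.
elim: t => [|t IH]; first by rewrite addn0 (minn_idPl ij).
have ltj : ev (PosE t < Arg true)%expr (minn (i + t) j < j).
  exact: (ev_lt w_gt0 IH (ev_arg _ i_lt j_lt true)).
apply: (ev_if w_gt0 i_lt j_lt m_lt ltj) => h.
- rewrite (_ : minn (i + t.+1) j = minn (i + t) j + 1); last first.
    by move: h; clear; lia.
  apply: ev_add => //; last by move: h j_lt; clear; lia.
  by apply: ev_lit; apply: leq_ltn_trans i_lt.
- rewrite (_ : minn (i + t.+1) j = minn (i + t) j) //.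
  by move: h; clear; lia.
Qed.

Lemma ev_scan u t : exists2 m, ev (ScanE u t) m &
  is_max (if u then lt else fun k l => lt l k) i (minn (i + t) j) m.
Proof.
elim: t => [|t [m em [mt mmax]]].
  exists i; first exact: (ev_arg _ i_lt j_lt false).
  rewrite addn0 (minn_idPl ij); split=> [|k ki]; first by rewrite leqnn.
  by rewrite eqn_leq andbC ki.
set p := minn (i + t.+1) j; set lt' := if u then lt else _.
have ep : ev (PosE t.+1) p by apply: ev_pos.
have pn : p <= n by apply: leq_trans (geq_minr _ _) jn.
have mn : m <= n by case/andP: mt => _ /leq_trans; apply;
  apply: leq_trans (geq_minr _ _) jn.
have tp : minn (i + t) j <= p by rewrite /p; clear; lia.
have ip : i <= p by rewrite /p leq_min ij leq_addr.
have ec : ev (if u then Fetch (ScanE u t) < Fetch (PosE t.+1)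
    else Fetch (PosE t.+1) < Fetch (ScanE u t))%expr
    (if u then rank lt n m < rank lt n p else rank lt n p < rank lt n m).
  have em' : ev (Fetch (ScanE u t)) (rank lt n m).
    by rewrite -memory_rank //; apply: ev_load.
  have ep' : ev (Fetch (PosE t.+1)) (rank lt n p).
    by rewrite -memory_rank //; apply: ev_load.
  by case: u {mmax lt' em} em' => em'; apply: (ev_lt w_gt0).
set c := (X in nat_of_bool X) in ec.
have cE : m != p -> c = lt' m p.
  by rewrite /c /lt' => mp; case: (u); rewrite rank_ltE // eq_sym.
exists (if c then p else m).
  by apply: (ev_if w_gt0 i_lt j_lt m_lt ec) => [-> //|/negPf ->].
have old k : i <= k <= p -> k != p -> i <= k <= minn (i + t) j.
  by rewrite /p; clear; lia.
have [mp|mp] := eqVneq m p.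
  rewrite mp if_same; split=> [|k kp kNp]; first by rewrite ip leqnn.
  by rewrite -mp; apply: mmax; rewrite ?old ?mp.
have lt'_trans : transitive lt'.
  by rewrite /lt'; case: (u) => // x y' z /[swap]; apply: lt_trans.
have lt'_total k l : k != l -> lt' k l || lt' l k.
  by rewrite /lt'; case: (u) => kl; rewrite ?lt_total // eq_sym.
rewrite cE //; case: ifP => h; split; rewrite ?ip ?leqnn //.
- move=> k kp kNp; have [->//|km] := eqVneq k m.
  by apply: lt'_trans h; apply: mmax; rewrite ?old.
- by case/andP: mt => -> /leq_trans; apply.
- move=> k kp km; have [kp'|kNp] := eqVneq k p; last by apply: mmax;
  rewrite ?old.
  by have := lt'_total _ _ mp; rewrite h kp'.
Qed.

End Ranks.

(** * Asymptotics *)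

(** With [y] half of [x], one factor [2 ^ y] absorbs degree [k] by induction and the other the
    additional factor; [x <= 3 * y] accounts for the powers of 3. *)
Lemma poly_le_exp k c : exists x0, forall x, x0 <= x -> c * x ^ k <= 2 ^ x.
Proof.
elim: k c => [|k IH] c.
  exists c => x cx; rewrite expn0 muln1.
  by apply: leq_trans cx (ltnW (ltn_expl x _)).
have [y0 hy] := IH (c * 3 ^ k.+1); exists (2 * y0 + 2) => x xy.
have [y yy0 [y1 yx xy3]] : exists2 y, y0 <= y & [/\ 0 < y,
  2 * y <= x & x <= 3 * y].
  exists (x %/ 2); first by clear -xy; lia.
  by split; clear -xy; lia.
apply: (@leq_trans (2 ^ y * 2 ^ y));
  last by rewrite -expnD leq_exp2l // addnn -mul2n.
apply: (@leq_trans ((c * 3 ^ k.+1 * y ^ k) * y)); last first.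
  by apply: leq_mul; [apply: hy|apply/ltnW/ltn_expl].
rewrite -[X in _ <= X]mulnA -expnSr -mulnA -expnMn leq_mul2l.
by rewrite leq_exp2r // xy3 orbT.
Qed.

(* The constants make each of the three terms of [redundancy], times M, at     *)
(* most n / 3.                                                                 *)
Definition large (K M w : nat) : Prop :=
  [/\ 8 <= w, 6 * lgw w < w, 2364 * M * lgw w ^ 2 <= block_len K w,
      6 * M <= w & 213 * M * w ^ 4 <= 2 ^ code_len K w].

(** Exponentials beat polynomials, applied to [code_len K w] for the table bound and to [lgw w] for
    the others, [w] lying between [2 ^ lgw w / 2] and [2 ^ lgw w]. *)
Lemma large_eventually K M : 0 < K -> exists w0, forall w,
  w0 <= w -> large K M w.
Proof.
move=> K0.
have [x1 h1] := poly_le_exp 4 (213 * M * (2 * K) ^ 4).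
have [x2 h2] := poly_le_exp 3 (2 * K * (2364 * M * 4 + 2)).
have [x3 h3] := poly_le_exp 1 24.
exists (8 + 6 * M + K * x1.+1 + 2 ^ x2 + 2 ^ x3) => w hw.
have w8 : 8 <= w by clear -hw; lia.
have wM : 6 * M <= w by clear -hw; lia.
have wK : K * x1.+1 <= w by move: hw; clear; lia.
have wx2 : 2 ^ x2 <= w by move: hw; clear; lia.
have wx3 : 2 ^ x3 <= w by move: hw; clear; lia.
set v := lgw w.
have wv : w <= 2 ^ v by apply: up_logP.
have vx2 : x2 <= v by rewrite -(@leq_exp2l 2) // (leq_trans wx2).
have vx3 : x3 <= v by rewrite -(@leq_exp2l 2) // (leq_trans wx3).
have v0 : 0 < v by rewrite up_log_gt0 //; clear -w8; lia.
have vw : 2 ^ v <= 2 * w by apply: exp_lgw_le; clear -w8; lia.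
split=> //.
- have := h3 v vx3; rewrite expn1 => h; move: vw h v0; clear; lia.
- rewrite /block_len -/v leq_divRL // /code_len.
  rewrite -ltnS; apply: (@leq_trans (w %/ K)); last by rewrite leqSpred.
  rewrite leq_divRL //.
  have := h2 v vx2 => h; have {h} := leq_trans h vw.
  have v3 : 0 < v ^ 3 by rewrite expn_gt0 v0.
  have v23 : v ^ 2 <= v ^ 3 by rewrite leq_pexp2l.
  have hX : (2364 * M * v ^ 2 * (2 * v).+2).+1 <= (2364 * M * 4 + 2) * v ^ 3.
    have -> : 2364 * M * v ^ 2 * (2 * v).+2 =
        2364 * M * 2 * v ^ 3 + 2364 * M * 2 * v ^ 2.
      by clear; rewrite !expnS expn0; lia.
    by move: v3 v23; move: (v ^ 3) (v ^ 2); clear => a c; nia.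
  move=> h; apply: (@leq_trans (K * ((2364 * M * 4 + 2) * v ^ 3))).
    by rewrite mulnC leq_mul2l hX orbT.
  by move: h; move: (2364 * M * 4 + 2) (v ^ 3); clear => a c; nia.
- apply: leq_trans (h1 (code_len K w) _); last first.
    by rewrite /code_len leq_divRL // mulnC (leq_trans _ wK) // leq_mul2l
      leqnSn orbT.
  rewrite -[X in _ <= X]mulnA -expnMn leq_mul2l leq_exp2r //; apply/orP; right.
  rewrite /code_len; have := divn_eq w K; have := ltn_pmod w K0.
  have : 0 < w %/ K.
    by rewrite divn_gt0 //; apply: leq_trans wK; rewrite leq_pmulr.
  by move: (w %/ K) (w %% K) => q r; clear; nia.
Qed.

(** The tables use one factor [2 ^ code_len K w] of [n]; the second one absorbs [w ^ 4] and the
    constants. *)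
Lemma redundancy_le K M w n : 0 < M -> large K M w -> 4 ^ code_len K w <= n ->
  M * redundancy K w n <= n.
Proof.
move=> M0 [w8 f_lt vs wM wb] bn; rewrite /redundancy.
set b := code_len K w in wb bn *; set s := block_len K w in vs *.
set v := lgw w in vs f_lt *.
have bb : 2 ^ b * 2 ^ b <= n by rewrite -expnMn.
have w4 : w <= w ^ 4 by rewrite -{1}[w]expn1 leq_pexp2l //; clear -w8; lia.
have wn : w <= n.
  apply: leq_trans w4 _; apply: (@leq_trans (2 ^ b)).
    by apply: leq_trans wb; rewrite leq_pmull // muln_gt0 M0.
  by apply: leq_trans bb; rewrite leq_pmulr // expn_gt0.
have sw : s <= w.
  apply: leq_trans (leq_div _ _) _; apply: leq_trans (leq_pred _) (leq_div _ _).
have t1 : 6 * (394 * M * v ^ 2 * (n %/ s)) <= n.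
  apply: leq_trans (leq_trunc_div n s); rewrite [n %/ s * s]mulnC.
  rewrite mulnA leq_mul2r; apply/orP; right; apply: leq_trans vs.
  by clear; lia.
have t2 : 6 * (394 * M * v ^ 2) <= n.
  by apply: leq_trans wn; apply: leq_trans sw; apply: leq_trans vs; clear; lia.
have t3 : 6 * (M * (n %/ w)) <= n.
  by apply: leq_trans (leq_trunc_div n w);
    rewrite mulnA mulnC leq_mul2l wM orbT.
have t4 : 213 * M * w ^ 4 * 2 ^ b <= n.
  by apply: leq_trans bb; rewrite leq_mul2r wb orbT.
move: t1 t2 t3 t4 => {wb bn vs wM w4 wn sw bb f_lt}; clearbody v s b.
move: (v ^ 2) (w ^ 4) (2 ^ b) (n %/ s) (n %/ w) => V W B q r; clear; lia.
Qed.

Lemma sublinear_nat (R : realType) (r : nat -> nat) :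
  (forall M, 0 < M -> exists n0, forall n, n0 <= n -> M * r n <= n) ->
  sublinear R r.
Proof.
move=> small; apply/eqoP => eps eps0 /=.
have [M M0 hM] : exists2 M, 0 < M & (1 <= eps * M%:R)%R.
  exists (Num.trunc (eps^-1)%R).+1 => //.
  have := ltW (@truncnS_gt _ (eps^-1)%R).
  by rewrite -ler_pdivrMl // mulr1.
have [n0 hn] := small _ M0.
exists n0 => // n /= n0n; rewrite !normr_nat.
apply: (@le_trans _ _ (eps * (M * r n)%:R)%R).
  by rewrite natrM mulrA ler_peMl.
by rewrite ler_pM2l // ler_nat hn.
Qed.

Lemma word_size_exp (R : realType) (w : nat -> nat) : word_size R w ->
  exists2 K, 0 < K & exists n0, forall n, n0 <= n -> 2 ^ w n <= n ^ K.
Proof.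
move=> [_]; rewrite eqThetaE bigThetaE => -[/eqOP wO _].
have [k [k0 [n0 _ hn]]] : exists k : R, (0 < k)%R /\ \forall n \near \oo,
    (`|(w n)%:R : R| <= k * `|lg (n%:R : R)|)%R.
  have [M [_ hM]] := wO; exists (`|M| + 1)%R; split.
    by rewrite ltr_wpDl.
  by apply: hM; rewrite (le_lt_trans (ler_norm M)) // ltrDl.
exists (Num.trunc k).+1 => //; exists n0.+1 => n n0n.
have := hn n (ltnW n0n) => /=; rewrite normr_nat.
have n1 : (1 <= n%:R :> R)%R by rewrite ler1n; apply: leq_ltn_trans n0n.
have ln2 : (0 < ln 2 :> R)%R by rewrite ln_gt0 // ltr1n.
have lg0 : (0 <= lg (n%:R : R))%R by apply: divr_ge0;
  [apply: ln_ge0|apply: ltW].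
rewrite ger0_norm // /lg mulrA ler_pdivlMr // => h.
rewrite -(ler_nat R) !natrX -ler_ln ?posrE ?exprn_gt0 ?(lt_le_trans ltr01 n1)
  //.
rewrite !lnXn ?(lt_le_trans ltr01 n1) // -[leLHS]mulr_natl -[leRHS]mulr_natl.
apply: (le_trans h); rewrite ler_wpM2r ?ln_ge0 //.
by apply: ltW; apply: truncnS_gt.
Qed.

(** * The order on positions and the assembly of the theorem *)

Section Array.
Variables (R : realType) (T : tie_rule) (n : nat) (A : n.-tuple R).

Lemma precedes_irr : irreflexive (precedes T A).
Proof. by move=> k; rewrite /precedes ltxx eqxx; case: T; rewrite ltnn. Qed.

Lemma precedes_trans : transitive (precedes T A).
Proof.
move=> l k m /orP[kl|/andP[/eqP kl h]] /orP[lm|/andP[/eqP lm h']];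
  rewrite /precedes.
- by rewrite (lt_trans kl lm).
- by rewrite -lm kl.
- by rewrite kl lm.
- rewrite kl lm eqxx /= orbC; case: T h h' => h h';
  rewrite ?(ltn_trans h h') //.
  by rewrite (ltn_trans h' h).
Qed.

Lemma precedes_total k l : k != l -> precedes T A k l || precedes T A l k.
Proof.
move=> kl; rewrite /precedes eq_sym;
  case: (ltgtP (entry A k) (entry A l)) => //= _.
by case: T; move: kl; rewrite neq_ltn => /orP[] ->; rewrite ?orbT.
Qed.

End Array.

Lemma is_max_shift (lt : rel nat) i j m : 0 < i -> i <= j ->
  is_max (fun k l => lt k.+1 l.+1) i.-1 j.-1 m -> is_max lt i j m.+1.
Proof.
case: i j => [//|i] [//|j] _ _ /= [mij mmax]; split=> // -[//|k] kij kl.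
exact: mmax.
Qed.

Lemma code_len_exp K w n : 0 < K -> 2 ^ w <= n ^ K ->
  4 ^ code_len (2 * K) w <= n.
Proof.
move=> K0 h; rewrite -(@leq_exp2r _ _ K) //; apply: leq_trans h.
rewrite /code_len -[4]/(2 ^ 2) -!expnM leq_exp2l //.
by have := leq_trunc_div w (2 * K); move: (w %/ _) => q; clear; lia.
Qed.

(* 2 ^ w0 vanishes modulo 2 ^ w if and only if w <= w0.                        *)
Definition SwitchE (w0 : nat) (e e' : expr) : expr :=
  IfE (Lit 0 < Lit (2 ^ w0))%expr e e'.

Lemma eval_switch w m i j w0 e e' : 0 < w -> i < 2 ^ w -> j < 2 ^ w ->
  (forall a, m a < 2 ^ w) ->
  eval_expr w m i j (SwitchE w0 e e') =
  eval_expr w m i j (if w0 < w then e else e').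
Proof.
move=> w_gt0 i_lt j_lt m_lt.
have any x : ev w m i j x (eval_expr w m i j x) by split=> //; apply: eval_lt.
have l0 : ev w m i j (Lit 0) 0 by apply: ev_lit; rewrite expn_gt0.
have := ev_lt w_gt0 l0 (any (Lit (2 ^ w0))).
rewrite [eval_expr w m i j (Lit _)]/= (_ : (0 < 2 ^ w0 %% 2 ^ w) = (w0 < w)).
  move=> ec; suff [] : ev w m i j (SwitchE w0 e e')
    (eval_expr w m i j (if w0 < w then e else e')) by [].
  by apply: (ev_if w_gt0 i_lt j_lt m_lt ec) => [->|/negPf ->].
have [h|h] := ltnP w0 w; first by rewrite modn_small ?ltn_exp2l ?expn_gt0.
by apply/negbTE; rewrite -leqNgt leqn0 -/(dvdn _ _) dvdn_exp2l.
Qed.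

Definition AnswerE (w0 : nat) (u : bool) : expr :=
  SwitchE w0 (QueryE u (Arg false - Lit 1) (Arg true - Lit 1) + Lit 1)%expr
    (ScanE u (2 ^ w0)).

Theorem theorem1 (R : realType) (w : nat -> nat) (T : tie_rule) :
  word_size R w ->
  exists (P : program) (t : nat) (r : nat -> nat),
    sublinear R r /\
    forall (n : nat) (A : n.-tuple R),
      exists D : seq bool,
        (size D <= 3 * n + r n)%N /\
        forall i j : nat, (1 <= i)%N -> (i <= j)%N -> (j <= n)%N ->
          exists l1 l2 : nat,
            is_RMinMax T A i j l1 l2 /\ answers_query (w n) P t D i j l1 l2.
Proof.
move=> wsz; have [n_lt _] := wsz.
have [K0 K0_gt0 [n0 wK]] := word_size_exp wsz.
(* The factor 2 keeps [2 ^ code_len K w] below the square root of [n]. *)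
pose K := 2 * K0; have K_gt0 : 0 < K by rewrite muln_gt0.
have [w1 large1] := large_eventually 1 K_gt0.
(* A word longer than [w0] forces both [n0 <= n] and [large], so a test on the word size alone
   selects the method, and [w0] can be built into the program. *)
pose w0 := maxn w1 (\max_(n < n0) w n).
have n0_le n : w0 < w n -> n0 <= n.
  move=> h; rewrite leqNgt; apply: contraL h => nn0; rewrite -leqNgt.
  apply: leq_trans (leq_maxr _ _).
  exact: (@leq_bigmax _ (fun n : 'I_n0 => w n) (Ordinal nn0)).
have code_le n : w0 < w n -> 4 ^ code_len K (w n) <= n.
  by move=> h; apply: code_len_exp => //; apply: wK; apply: n0_le.
exists (program_of (AnswerE w0 true) (AnswerE w0 false)).
exists (size (program_of (AnswerE w0 true) (AnswerE w0 false))).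
exists (fun n => if w0 < w n then redundancy K (w n) n else w n * 2 ^ w n).
split.
  apply: sublinear_nat => M M_gt0; have [w2 large2] := large_eventually M K_gt0.
  exists (2 ^ maxn w0 w2) => n nM.
  have : maxn w0 w2 < w n by rewrite -(@ltn_exp2l 2) // (leq_ltn_trans nM).
  rewrite gtn_max => /andP[w0n w2n]; rewrite w0n.
  by apply: redundancy_le => //; [apply: large2; apply: ltnW|apply: code_le].
move=> n A; have irr := precedes_irr T A; have tr := @precedes_trans _ T _ A.
have tot := @precedes_total _ T _ A.
have answers D : (forall i j, 0 < i -> i <= j -> j <= n -> forall u,
      is_max (if u then precedes T A else fun k l => precedes T A l k) i j
        (eval_expr (w n) (memory_of_bits (w n) D) i j (AnswerE w0 u))) ->
    forall i j, 0 < i -> i <= j -> j <= n -> exists l1 l2,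
      is_RMinMax T A i j l1 l2 /\
      answers_query (w n) (program_of (AnswerE w0 true) (AnswerE w0 false))
        (size (program_of (AnswerE w0 true) (AnswerE w0 false))) D i j l1 l2.
  move=> correct i j i_gt0 ij jn; do 2 eexists; split; last exact: program_ofP.
  split; [exact: correct i j i_gt0 ij jn true|exact: correct i j i_gt0 ij jn
    false].
have evalE D i j u : 0 < i -> i <= j -> j <= n ->
    eval_expr (w n) (memory_of_bits (w n) D) i j (AnswerE w0 u) =
    eval_expr (w n) (memory_of_bits (w n) D) i j (if w0 < w n
      then (QueryE u (Arg false - Lit 1) (Arg true - Lit 1) + Lit 1)%expr
      else ScanE u (2 ^ w0)).
  move=> i_gt0 ij jn; have j_lt := leq_ltn_trans jn (n_lt n).
  apply: eval_switch => //; last exact: memory_of_bits_lt.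
    by case: (w n) j_lt => //; rewrite expn0 ltnS leqn0 => /eqP j0;
      move: ij i_gt0; rewrite j0; case: (i).
  exact: leq_ltn_trans j_lt.
have [w0n|wn0] := ltnP w0 (w n).
- have [w8 f_lt vs _ _] := large1 _ (ltnW (leq_ltn_trans (leq_maxl _ _) w0n)).
  have red_le : redundancy K (w n) n <= n.
    rewrite -[redundancy _ _ _]mul1n; apply: redundancy_le => //;
      last exact: code_le.
    by apply: large1; apply: ltnW (leq_ltn_trans (leq_maxl _ _) w0n).
  have s_gt0 : 0 < block_len K (w n).
    have v_gt0 : 0 < lgw (w n) by rewrite up_log_gt0 (leq_trans _ w8).
    by apply: leq_trans vs; rewrite muln1 muln_gt0 expn_gt0 v_gt0.
  have K_gt1 : 1 < K by rewrite /K -{1}[2]muln1 leq_mul2l.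
  have [||| U [y [y_sum X_le y_max]]] := @pops_encoding
    (fun k l => precedes T A k.+1 l.+1) n.
  + by move=> k; apply: irr.
  + by move=> k l m; apply: tr.
  + by move=> k l kl; apply: tot.
  exists (encoding K (w n) n U y); split; first exact: size_encoding.
  apply: answers => i j i_gt0 ij jn u; rewrite evalE // w0n.
  have [m bm ->] := ev_encoding (n_lt n) w8 K_gt1 s_gt0 f_lt red_le y_sum X_le
    u i_gt0 ij jn.
  have j1n : j.-1 < n by rewrite prednK // (leq_trans i_gt0).
  have ij1 : i.-1 <= j.-1 by rewrite -!subn1 leq_sub2r.
  have := y_max u _ _ _ ij1 j1n bm.
  case: u {bm} => h; first exact: (is_max_shift (lt := precedes T A)).
  exact: (is_max_shift (lt := fun k l => precedes T A l k)).
- exists (ranks (precedes T A) n (w n)).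
  split; first by rewrite size_ranks leq_addl.
  apply: answers => i j i_gt0 ij jn u; rewrite evalE // ltnNge wn0 /=.
  (* Since [n < 2 ^ w n <= 2 ^ w0], this many steps bring the cursor to [j]. *)
  have [m [-> _]] := ev_scan irr tr tot (n_lt n) i_gt0 ij jn u (2 ^ w0).
  rewrite (minn_idPr _) //; apply: leq_trans (leq_addl i _).
  by apply: leq_trans jn _; apply: leq_trans (ltnW (n_lt n)) _;
    rewrite leq_exp2l.
Qed.
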